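(* Let $\phi: M_3(\mathbb{C})\to M_3(\mathbb{C})$ be a PPT map. Then the composition $\phi\circ\phi$ is separable (entanglement breaking), i.e. its Choi matrix $C_{\phi\circ\phi}=\sum_{i,j=0}^{2}|i\rangle\langle j|\otimes(\phi\circ\phi)(|i\rangle\langle j|)\in M_3\otimes M_3$ is a separable positive semidefinite matrix.
   Context: A linear map $\phi: M_n(\mathbb{C})\to M_n(\mathbb{C})$ is called a PPT map if it is both completely positive and completely copositive (i.e. both $\phi$ and $T\circ\phi$ are completely positive, where $T$ is the transpose). A positive semidefinite matrix in $M_m\otimes M_n$ is separable if it is a convex combination (nonnegative combination) of product matrices $\alpha\otimes\beta$ with $\alpha,\beta$ positive semidefinite. A map $\psi$ on $M_n$ is called separable (entanglement breaking) if its Choi matrix $C_\psi=\sum_{i,j}|i\rangle\langle j|\otimes\psi(|i\rangle\langle j|)$ is separable. *)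

(* Defs.v *)
From HB Require Import structures.
From mathcomp Require Import all_boot all_order all_algebra.
From mathcomp Require Import complex mxtens.
From mathcomp Require Import reals.
Set Implicit Arguments. Unset Strict Implicit. Unset Printing Implicit Defensive.
Import Order.TTheory GRing.Theory Num.Theory.
Local Open Scope ring_scope.

Section QDefs.
Variable C : numClosedFieldType.

Definition adjmx (m n : nat) (A : 'M[C]_(m, n)) : 'M[C]_(n, m) :=
  (map_mx Num.conj A)^T.

Definition psd (n : nat) (A : 'M[C]_n) : Prop :=
  adjmx A = A /\ forall v : 'cV[C]_n, 0 <= (adjmx v *m A *m v) 0 0.

(* the (a,b) block of X in M_k (x) M_n, i.e. X = sum_{a,b} |a><b| (x) blk X a b *)
Definition blk (k n : nat) (X : 'M[C]_(k * n)) (a b : 'I_k) : 'M[C]_n :=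
  \matrix_(i, j) X (mxtens_index (a, i)) (mxtens_index (b, j)).

(* the ampliation id_k (x) phi acting on M_k (x) M_n *)
Definition ampl (k n : nat) (phi : 'M[C]_n -> 'M[C]_n) (X : 'M[C]_(k * n))
  : 'M[C]_(k * n) :=
  \matrix_(p, q) phi (blk X (mxtens_unindex p).1 (mxtens_unindex q).1)
                   (mxtens_unindex p).2 (mxtens_unindex q).2.

Definition completely_positive (n : nat) (phi : 'M[C]_n -> 'M[C]_n) : Prop :=
  forall (k : nat) (X : 'M[C]_(k * n)), psd X -> psd (ampl phi X).

Definition completely_copositive (n : nat) (phi : 'M[C]_n -> 'M[C]_n) : Prop :=
  completely_positive (fun X => (phi X)^T).

Definition PPT (n : nat) (phi : 'M[C]_n -> 'M[C]_n) : Prop :=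
  completely_positive phi /\ completely_copositive phi.

Definition separable (m n : nat) (A : 'M[C]_(m * n)) : Prop :=
  psd A /\
  exists (N : nat) (c : 'I_N -> C) (alpha : 'I_N -> 'M[C]_m) (beta : 'I_N -> 'M[C]_n),
    [/\ forall t, 0 <= c t, forall t, psd (alpha t), forall t, psd (beta t)
      & A = \sum_(t < N) c t *: (alpha t *t beta t)].

Definition choi (n : nat) (psi : 'M[C]_n -> 'M[C]_n) : 'M[C]_(n * n) :=
  \sum_(i < n) \sum_(j < n) (delta_mx i j *t psi (delta_mx i j)).

Definition separable_map (n : nat) (psi : 'M[C]_n -> 'M[C]_n) : Prop :=
  separable (choi psi).

End QDefs.

(* Main.v *)
(** Write <W, C> for the pairing of the Choi matrix of [phi o phi] with a
block-positive [W], and let [P] be the positive map attached to [W], so that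
<W, C> = sum_ij (P (phi (phi E_ij)))_ij.  By duality it suffices that this is
nonnegative.  Restricted to a two-dimensional input space [phi] is a 2 x 3 PPT
map, hence separable by Stormer-Woronowicz, so [L = P o phi] is 2-positive.  The
Schur complement of the blocks [L E_kl] at [L E_00] writes [L] as a completely
positive map plus a positive map killing the row and the column of index 0, which
therefore only sees a 2-dimensional compression of its input.  Composing with
[phi], the first part is nonnegative because [phi] is completely positive, the
second because the compression of [phi] is again a 2 x 3 PPT map, hence separable.

For Stormer-Woronowicz (2 x n, n <= 3) write rho = R1* R1 and its partial
transpose as R2* R2, with r1 and r2 rows.  If r1 <= n or r2 <= n some product
vector is in the kernel and splits off, reducing n.  If r1^2 + r2^2 > 4 n^2 + 1 a
dimension count shows that rho is not extremal among PPT matrices, and rho is a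
sum of two PPT matrices of smaller ranks.  The only remaining case is n = 3,
r1 = r2 = 4, where rho has a normal dilation of size 4. *)
Require Import Defs.
From HB Require Import structures.
From mathcomp Require Import all_boot all_order all_algebra.
From mathcomp Require Import complex mxtens.
From mathcomp Require Import reals.
From mathcomp Require Import boolp classical_sets.
From mathcomp Require Import topology normedtype derive.
From mathcomp Require Import ring lra zify.
Import Order.TTheory GRing.Theory Num.Theory.
Import numFieldNormedType.Exports.
Local Open Scope ring_scope.
Set Implicit Arguments. Unset Strict Implicit. Unset Printing Implicit Defensive.

Local Notation "A ^H" := (adjmx A) (at level 2, format "A ^H") : ring_scope.

(** * Adjoints and positive semidefinite matrices *)

Section Adjoint.
Variable C : numClosedFieldType.

Lemma adjmxE m n (A : 'M[C]_(m, n)) i j : A^H i j = (A j i)^*.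
Proof. by rewrite !mxE. Qed.

Lemma adjmxK m n (A : 'M[C]_(m, n)) : A^H^H = A.
Proof. by apply/matrixP => i j; rewrite !mxE conjCK. Qed.

Lemma adjmxD m n (A B : 'M[C]_(m, n)) : (A + B)^H = A^H + B^H.
Proof. by apply/matrixP => i j; rewrite !mxE rmorphD. Qed.

Lemma adjmxN m n (A : 'M[C]_(m, n)) : (- A)^H = - A^H.
Proof. by apply/matrixP => i j; rewrite !mxE rmorphN. Qed.

Lemma adjmxB m n (A B : 'M[C]_(m, n)) : (A - B)^H = A^H - B^H.
Proof. by rewrite adjmxD adjmxN. Qed.

Lemma adjmxZ m n c (A : 'M[C]_(m, n)) : (c *: A)^H = c^* *: A^H.
Proof. by apply/matrixP => i j; rewrite !mxE rmorphM. Qed.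

Lemma adjmx0 m n : (0 : 'M[C]_(m, n))^H = 0.
Proof. by apply/matrixP => i j; rewrite !mxE rmorph0. Qed.

Lemma adjmx1 n : (1%:M : 'M[C]_n)^H = 1%:M.
Proof. by apply/matrixP => i j; rewrite !mxE eq_sym; case: eqP => _; rewrite ?rmorph1 ?rmorph0. Qed.

Lemma adjmx_sum I (r : seq I) (P : pred I) m n (F : I -> 'M[C]_(m, n)) :
  (\sum_(i <- r | P i) F i)^H = \sum_(i <- r | P i) (F i)^H.
Proof. by elim/big_rec2: _ => [|i A B _ <-]; rewrite ?adjmx0 ?adjmxD. Qed.

Lemma adjmxM m n p (A : 'M[C]_(m, n)) (B : 'M[C]_(n, p)) : (A *m B)^H = B^H *m A^H.
Proof. by rewrite /adjmx map_mxM trmx_mul. Qed.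

Lemma adjmx_block m n p q (A : 'M[C]_(m, p)) (B : 'M[C]_(m, q))
    (D : 'M[C]_(n, p)) (E : 'M[C]_(n, q)) :
  (block_mx A B D E)^H = block_mx A^H D^H B^H E^H.
Proof. by rewrite /adjmx map_block_mx tr_block_mx. Qed.

Lemma adjmx_row m n p (A : 'M[C]_(m, n)) (B : 'M[C]_(m, p)) :
  (row_mx A B)^H = col_mx A^H B^H.
Proof. by rewrite /adjmx map_row_mx tr_row_mx. Qed.

Lemma adjmx_col m n p (A : 'M[C]_(m, p)) (B : 'M[C]_(n, p)) :
  (col_mx A B)^H = row_mx A^H B^H.
Proof. by rewrite /adjmx map_col_mx tr_col_mx. Qed.

Lemma gram_col_ge0 n (v : 'cV[C]_n) : 0 <= (v^H *m v) 0 0.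
Proof.
by rewrite mxE sumr_ge0 // => i _; rewrite adjmxE mulrC mul_conjC_ge0.
Qed.

Lemma gram_col_eq0 n (v : 'cV[C]_n) : (v^H *m v) 0 0 = 0 -> v = 0.
Proof.
rewrite mxE => /psumr_eq0P h; apply/colP => i; rewrite mxE.
have /eqP : v^H 0 i * v i 0 = 0.
  by apply: h => // j _; rewrite adjmxE mulrC mul_conjC_ge0.
by rewrite adjmxE mulrC mul_conjC_eq0 => /eqP.
Qed.

Lemma psd_gram m n (R : 'M[C]_(m, n)) : psd (R^H *m R).
Proof.
split=> [|v]; first by rewrite adjmxM adjmxK.
by rewrite !mulmxA -adjmxM -mulmxA gram_col_ge0.
Qed.

Lemma psd_congr m n (T : 'M[C]_(n, m)) (A : 'M[C]_n) : psd A -> psd (T^H *m A *m T).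
Proof.
case=> hA pA; split=> [|v]; first by rewrite !adjmxM adjmxK hA mulmxA.
by rewrite !mulmxA -adjmxM -mulmxA pA.
Qed.

Lemma psdD n (A B : 'M[C]_n) : psd A -> psd B -> psd (A + B).
Proof.
case=> hA pA [hB pB]; split=> [|v]; first by rewrite adjmxD hA hB.
by rewrite mulmxDr mulmxDl mxE addr_ge0.
Qed.

Lemma psd0 n : psd (0 : 'M[C]_n).
Proof. by split=> [|v]; rewrite ?adjmx0 ?mulmx0 ?mul0mx ?mxE. Qed.

Lemma normal_spectral n (N : 'M[C]_n) : N *m N^H = N^H *m N ->
  exists (P : 'M[C]_n) (d : 'rV[C]_n),
    [/\ P *m P^H = 1%:M, P^H *m P = 1%:M & N = P^H *m diag_mx d *m P].
Proof.
move=> hN; have E m p (A : 'M[C]_(m, p)) : map_mx Num.conj A^T = A^H.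
  by apply/matrixP => i j; rewrite !mxE.
have /orthomx_spectralP : N \is normalmx by apply/normalmxP; rewrite E.
have /unitarymxP := spectral_unitarymx N; have U := spectral_unit N; rewrite E => hP.
move: (spectralmx N) (spectral_diag N) hP U => P d hP U.
have -> : invmx P = P^H by rewrite -[LHS]mulmx1 -hP mulmxA mulVmx // mul1mx.
move=> ->; exists P, d; split=> //.
by rewrite -[P^H]mul1mx -(mulVmx U) -[_ *m P *m _]mulmxA hP mulmx1 mulVmx.
Qed.

Lemma diag_mxC_conj n (d : 'rV[C]_n) : (diag_mx d)^H = diag_mx (map_mx Num.conj d).
Proof.
apply/matrixP => i j; rewrite !mxE eq_sym; case: eqP => [->|_] //=.
by rewrite !mulr0n rmorph0.
Qed.

Lemma hermitian_spectral n (N : 'M[C]_n) : N^H = N ->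
  exists (P : 'M[C]_n) (d : 'rV[C]_n),
    [/\ P *m P^H = 1%:M, P^H *m P = 1%:M, N = P^H *m diag_mx d *m P
      & forall i, d 0 i \is Num.real].
Proof.
move=> hN; have [|P [d [P1 P2 E]]] := @normal_spectral n N; first by rewrite hN.
exists P, d; split=> // i; apply/CrealP.
have D : diag_mx d = P *m N *m P^H by rewrite E !mulmxA P1 mul1mx -mulmxA P1 mulmx1.
have /matrixP/(_ i i) : (diag_mx d)^H = diag_mx d.
  by rewrite D !adjmxM adjmxK hN mulmxA.
by rewrite adjmxE !mxE eqxx !mulr1n.
Qed.

Lemma mulmx_diag_sum n m (P : 'M[C]_(n, m)) (d : 'rV[C]_n) :
  P^H *m diag_mx d *m P = \sum_i d 0 i *: ((row i P)^H *m row i P).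
Proof.
apply/matrixP => a b; rewrite summxE !mxE; apply: eq_bigr => i _.
rewrite !mxE (bigD1 i) //= big1 ?big_ord1 => [|j /negPf ji].
  by rewrite !mxE eqxx !mulr1n addr0; ring.
by rewrite !mxE ji mulr0n mulr0.
Qed.

Lemma diag_ge0_factor n m (P : 'M[C]_(n, m)) (d : 'rV[C]_n) :
  (forall i, 0 <= d 0 i) -> exists R : 'M[C]_(n, m), P^H *m diag_mx d *m P = R^H *m R.
Proof.
move=> d0; exists (diag_mx (map_mx sqrtC d) *m P); rewrite adjmxM diag_mxC_conj.
rewrite mulmxA -[in RHS](mulmxA P^H) mulmx_diag; congr (_ *m diag_mx _ *m _).
apply/rowP => i; rewrite !mxE geC0_conj ?sqrtC_ge0 //.
by rewrite -expr2 sqrtCK.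
Qed.

(** A zero eigenvalue contributes nothing to the spectral sum, so its row can be deleted. The strict
    decrease of row counts in the extremality argument comes from here. *)
Lemma diag_ge0_factor_singular n m (P : 'M[C]_(n.+1, m)) (d : 'rV[C]_n.+1) k :
  (forall i, 0 <= d 0 i) -> d 0 k = 0 ->
  exists R : 'M[C]_(n, m), P^H *m diag_mx d *m P = R^H *m R.
Proof.
move=> d0 dk; have -> : P^H *m diag_mx d *m P =
    (row' k P)^H *m diag_mx (col' k d) *m row' k P.
  rewrite !mulmx_diag_sum (bigD1_ord k) //= dk scale0r add0r.
  apply: eq_bigr => i _; rewrite mxE; congr (_ *: _).
  by congr (_^H *m _); apply/rowP => j; rewrite !mxE.
by apply: diag_ge0_factor => i; rewrite mxE.
Qed.

Lemma psd_spectral n (A : 'M[C]_n) : psd A ->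
  exists (P : 'M[C]_n) (d : 'rV[C]_n),
    [/\ P *m P^H = 1%:M, P^H *m P = 1%:M, A = P^H *m diag_mx d *m P
      & forall i, 0 <= d 0 i].
Proof.
case=> hA pA; have [P [d [P1 P2 E _]]] := hermitian_spectral hA.
exists P, d; split=> // i.
have D : diag_mx d = P *m A *m P^H by rewrite E !mulmxA P1 mul1mx -mulmxA P1 mulmx1.
set e := delta_mx i 0 : 'cV[C]_n.
have := pA (P^H *m e); rewrite adjmxM adjmxK.
have -> : e^H *m P *m A *m (P^H *m e) = e^H *m diag_mx d *m e by rewrite D !mulmxA.
rewrite mxE (bigD1 i) //= big1 => [|j /negPf ji]; last first.
  by rewrite [X in _ * X]mxE ji mulr0.
rewrite addr0 !mxE (bigD1 i) //= big1 => [|j /negPf ji].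
  by rewrite addr0 !mxE !eqxx !mulr1n rmorph1 mul1r mulr1.
by rewrite !mxE ji rmorph0 mul0r.
Qed.

Lemma psd_factor n (A : 'M[C]_n) : psd A -> exists R : 'M[C]_n, A = R^H *m R.
Proof. by case/psd_spectral => P [d [_ _ -> d0]]; apply: diag_ge0_factor. Qed.

Lemma psd_kernel n (A : 'M[C]_n) (v : 'cV[C]_n) :
  psd A -> (v^H *m A *m v) 0 0 = 0 -> A *m v = 0.
Proof.
case/psd_factor => R ->; rewrite !mulmxA -adjmxM -mulmxA => /gram_col_eq0 Rv.
by rewrite -mulmxA Rv mulmx0.
Qed.

(** Some eigenvalue is zero: otherwise [diag_mx d *m (P *m v) = 0] would force [P *m v = 0], hence v
    = 0. *)
Lemma psd_factor_singular n (A : 'M[C]_n.+1) (v : 'cV[C]_n.+1) :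
  psd A -> v != 0 -> A *m v = 0 -> exists R : 'M[C]_(n, n.+1), A = R^H *m R.
Proof.
case/psd_spectral => P [d [_ P2 -> d0]] v0 Av.
have [k /eqP dk] : exists k, d 0 k == 0.
  apply/existsP/(contraNT _ v0) => /existsPn dn0; apply/eqP.
  rewrite -[v]mul1mx -P2 -mulmxA (_ : P *m v = 0) ?mulmx0 //.
  apply/colP => i; rewrite mxE; apply/eqP.
  have : diag_mx d *m (P *m v) = 0.
    rewrite -[LHS]mul1mx.
    have : P^H *m (diag_mx d *m (P *m v)) = 0 by rewrite !mulmxA.
    move/(congr1 (mulmx P)); rewrite mulmx0 mulmxA.
    by move/mulmx1C: P2 => ->; rewrite mul1mx => ->.
  move/colP/(_ i); rewrite mxE (bigD1 i) //= big1 => [|j /negPf ji].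
    rewrite !mxE eqxx mulr1n addr0 => /eqP; rewrite mulf_eq0.
    by move: (dn0 i) => /negPf ->.
  by rewrite mxE eq_sym ji mulr0n mul0r.
exact: diag_ge0_factor_singular dk.
Qed.

Lemma psd_antisym n (A : 'M[C]_n) : psd A -> psd (- A) -> A = 0.
Proof.
move=> pA [_ pN]; have [_ pA'] := pA.
suff Av (v : 'cV[C]_n) : A *m v = 0.
  by apply/matrixP => i j; have /colP/(_ i) := Av (delta_mx j 0);
     rewrite -colE !mxE.
apply: psd_kernel => //; apply/eqP; rewrite eq_le pA' andbT.
by have := pN v; rewrite mulmxN mulNmx mxE oppr_ge0.
Qed.

End Adjoint.

(** * Matrices in M_2 (x) M_n as triples of blocks *)

Section QubitBlocks.
Variable C : numClosedFieldType.

(* The triple (A, B, D) stands for [[A, B], [B*, D]] in M_2 (x) M_n; exchanging B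
   and B* is the partial transpose on the M_2 factor. *)
Definition ppt2 n (A B D : 'M[C]_n) : Prop :=
  psd (block_mx A B B^H D) /\ psd (block_mx A B^H B D).

(** The separable cone of M_2 (x) M_n, generated by the rank-one matrices of the product vectors
    (z0, z1) (x) v. As an inductive predicate it yields each closure property by one induction. *)
Inductive sep2 n : 'M[C]_n -> 'M[C]_n -> 'M[C]_n -> Prop :=
| sep2_0 : sep2 0 0 0
| sep2_prod (z0 z1 : C) (v : 'cV[C]_n) :
    sep2 ((z0 * z0^*) *: (v *m v^H)) ((z0 * z1^*) *: (v *m v^H))
         ((z1 * z1^*) *: (v *m v^H))
| sep2_add A B D A' B' D' :
    sep2 A B D -> sep2 A' B' D' -> sep2 (A + A') (B + B') (D + D').

Lemma adj_rank1 n (v : 'cV[C]_n) : (v *m v^H)^H = v *m v^H.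
Proof. by rewrite adjmxM adjmxK. Qed.

Lemma sep2_conj n (A B D : 'M[C]_n) : sep2 A B D -> sep2 A B^H D.
Proof.
elim=> [|z0 z1 v|A1 B1 D1 A2 B2 D2 _ s1 _ s2].
- by rewrite adjmx0; apply: sep2_0.
- rewrite adjmxZ adj_rank1 rmorphM /= conjCK.
  by have := sep2_prod z0^* z1^* v; rewrite !conjCK [z0^* * z0]mulrC [z1^* * z1]mulrC.
- by rewrite adjmxD; apply: sep2_add.
Qed.

Lemma sep2_swap n (A B D : 'M[C]_n) : sep2 A B D -> sep2 D B^H A.
Proof.
elim=> [|z0 z1 v|A1 B1 D1 A2 B2 D2 _ s1 _ s2].
- by rewrite adjmx0; apply: sep2_0.
- by rewrite adjmxZ adj_rank1 rmorphM /= conjCK [z0^* * _]mulrC; apply: sep2_prod.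
- by rewrite adjmxD; apply: sep2_add.
Qed.

Lemma sep2_congr m n (T : 'M[C]_(m, n)) A B D :
  sep2 A B D -> sep2 (T *m A *m T^H) (T *m B *m T^H) (T *m D *m T^H).
Proof.
elim=> [|z0 z1 v|A1 B1 D1 A2 B2 D2 _ s1 _ s2].
- by rewrite mulmx0 mul0mx; apply: sep2_0.
- have := sep2_prod z0 z1 (T *m v); rewrite adjmxM !mulmxA.
  by rewrite -!scalemxAr -!scalemxAl !mulmxA.
- by rewrite !mulmxDr !mulmxDl; apply: sep2_add.
Qed.

Lemma sep2_scale n c (A B D : 'M[C]_n) :
  0 <= c -> sep2 A B D -> sep2 (c *: A) (c *: B) (c *: D).
Proof.
move=> c0; elim=> [|z0 z1 v|A1 B1 D1 A2 B2 D2 _ s1 _ s2].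
- by rewrite scaler0; apply: sep2_0.
- have := sep2_prod z0 z1 (sqrtC c *: v).
  rewrite adjmxZ [(sqrtC c)^*]geC0_conj ?sqrtC_ge0 // -scalemxAr -scalemxAl.
  rewrite [_ *: (_ *: (v *m _))]scalerA -expr2 sqrtCK.
  by rewrite !scalerA !(mulrC c).
- by rewrite !scalerDr; apply: sep2_add.
Qed.

(** This is the change of basis of the qubit factor that takes (z0, z1) to (z0 + conj(l) z1, z1). *)
Lemma sep2_shear n l (A B D : 'M[C]_n) : sep2 A B D ->
  sep2 (A + l *: B + l^* *: B^H + (l * l^*) *: D) (B + l^* *: D) D.
Proof.
elim=> [|z0 z1 v|A1 B1 D1 A2 B2 D2 _ s1 _ s2].
- by rewrite adjmx0 !scaler0 !addr0; apply: sep2_0.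
- have := sep2_prod (z0 + l^* * z1) z1 v.
  rewrite adjmxZ adj_rank1 !rmorphD !rmorphM /= !conjCK !scalerA -!scalerDl.
  by congr (sep2 (_ *: _) (_ *: _) _); ring.
- have := sep2_add s1 s2; rewrite !scalerDr adjmxD !scalerDr.
  by congr (sep2 _ _ _); apply/matrixP => i j; rewrite !mxE; ring.
Qed.

Lemma ppt2_conj n (A B D : 'M[C]_n) : ppt2 A B D -> ppt2 A B^H D.
Proof. by case=> p q; split=> //; rewrite adjmxK. Qed.

Lemma psd_block_congr n p (T : 'M[C]_(n + n, p + p)) A B D E A' B' D' E' :
  T^H *m block_mx A B D E *m T = block_mx A' B' D' E' ->
  psd (block_mx A B D E : 'M[C]_(n + n)) -> psd (block_mx A' B' D' E' : 'M[C]_(p + p)).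
Proof. by move=> <-; apply: psd_congr. Qed.

Lemma ppt2_swap n (A B D : 'M[C]_n) : ppt2 A B D -> ppt2 D B^H A.
Proof.
case=> p q; split; [apply: psd_block_congr p | apply: psd_block_congr q];
  instantiate (1 := block_mx 0 1%:M 1%:M 0);
  rewrite adjmx_block adjmx0 adjmx1 !mulmx_block ?adjmxK;
  by rewrite !mul0mx !mulmx0 !mul1mx !mulmx1 ?addr0 ?add0r ?mul0mx ?add0r ?mulmx0.
Qed.

Lemma ppt2_congr m n (T : 'M[C]_(n, m)) (A B D : 'M[C]_n) : ppt2 A B D ->
  ppt2 (T^H *m A *m T) (T^H *m B *m T) (T^H *m D *m T).
Proof.
case=> p q; split; [apply: psd_block_congr p | apply: psd_block_congr q];
  instantiate (1 := block_mx T 0 0 T);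
  rewrite adjmx_block !adjmx0 !mulmx_block !adjmxM adjmxK;
  by rewrite !mul0mx !mulmx0 ?addr0 ?add0r ?mul0mx ?add0r ?mulmx0 ?add0r ?addr0 ?mulmxA.
Qed.

Lemma ppt2_shear n l (A B D : 'M[C]_n) : ppt2 A B D ->
  ppt2 (A + l *: B + l^* *: B^H + (l * l^*) *: D) (B + l^* *: D) D.
Proof.
case=> p q; have hD : D^H = D.
  by case: p => + _; rewrite adjmx_block => /eq_block_mx[].
(* Partial transposition conjugates the qubit change of basis, hence [l] in one congruence and [l^*]
   in the other. *)
split; [apply: psd_block_congr p | apply: psd_block_congr q];
  [instantiate (1 := block_mx 1%:M 0 (l *: 1%:M) 1%:M)
  |instantiate (1 := block_mx 1%:M 0 (l^* *: 1%:M) 1%:M)];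
  rewrite adjmx_block !adjmx0 !mulmx_block !adjmxZ !adjmx1 ?adjmxD ?adjmxZ ?conjCK ?hD;
  rewrite !mul0mx !mulmx0 !mul1mx !mulmx1 ?add0r ?addr0 -?scalemxAl ?mul1mx -?scalemxAr ?mulmx1.
all: by congr block_mx; apply/matrixP => i j; rewrite !mxE; ring.
Qed.

Lemma ppt2_hermA n (A B D : 'M[C]_n) : ppt2 A B D -> A^H = A.
Proof. by case=> [[+ _] _]; rewrite adjmx_block => /eq_block_mx[]. Qed.

Lemma ppt2_hermD n (A B D : 'M[C]_n) : ppt2 A B D -> D^H = D.
Proof. by move/ppt2_swap/ppt2_hermA. Qed.

Lemma psd_block_ul n (A B B' D : 'M[C]_n) : psd (block_mx A B B' D) -> psd A.
Proof.
move/(psd_congr (col_mx 1%:M 0)); rewrite adjmx_col adjmx1 adjmx0 mul_row_block mul_row_col.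
by rewrite !mul0mx mulmx1 mulmx0 mul1mx !addr0.
Qed.

Lemma ppt2_psdA n (A B D : 'M[C]_n) : ppt2 A B D -> psd A.
Proof. by case=> /psd_block_ul. Qed.

Lemma ppt2_psdD n (A B D : 'M[C]_n) : ppt2 A B D -> psd D.
Proof. by move/ppt2_swap/ppt2_psdA. Qed.

(** The vector (v, 0) has zero quadratic form, so it lies in the kernel of the block matrix, whose
    lower block then gives [B^H *m v = 0]. The partial transpose gives [B *m v = 0] likewise. *)
Lemma ppt2_kerA n (A B D : 'M[C]_n) (v : 'cV[C]_n) :
  ppt2 A B D -> A *m v = 0 -> B *m v = 0 /\ B^H *m v = 0.
Proof.
suff h X : psd (block_mx A X X^H D) -> A *m v = 0 -> X^H *m v = 0.
  by case=> p q Av; split; [rewrite -[B]adjmxK|]; apply: h; rewrite ?adjmxK.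
move=> p Av; have := psd_kernel (v := col_mx v 0) p.
rewrite adjmx_col adjmx0 mul_row_block !mul0mx !addr0 mul_row_col mulmx0 addr0.
rewrite -mulmxA Av mulmx0 mxE => /(_ erefl).
by rewrite mul_block_col !mulmx0 !addr0 => /eqP; rewrite col_mx_eq0 => /andP[_ /eqP].
Qed.

End QubitBlocks.

(** * Splitting off a product vector in the kernel *)

Section Split.
Variable C : numClosedFieldType.

Lemma mulmx_gram n p (w : 'M[C]_(p, 1)) (u v : 'cV[C]_n) :
  w *m u^H *m v = (u^H *m v) 0 0 *: w.
Proof. by rewrite -mulmxA [u^H *m v]mx11_scalar mul_mx_scalar !mxE eqxx mulr1n. Qed.

Lemma gram_col_gt0 n (v : 'cV[C]_n) : v != 0 -> 0 < (v^H *m v) 0 0.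
Proof.
move=> v0; rewrite lt_def gram_col_ge0 andbT.
by apply: contraNneq v0 => /gram_col_eq0 ->.
Qed.

(** The orthogonal projector P off v is singular, so it factors as [L^H *m L] with one row fewer,
    and A = P A P. Matrices killing v on both sides thus live in dimension n. *)
Lemma ortho_projector_factor n (v : 'cV[C]_n.+1) : v != 0 ->
  exists L : 'M[C]_(n, n.+1),
    forall A, A *m v = 0 -> A^H *m v = 0 -> A = L^H *m (L *m A *m L^H) *m L^H^H.
Proof.
move=> v0; have := gram_col_gt0 v0; set N := (v^H *m v) 0 0 => N0.
pose P := 1%:M - N^-1 *: (v *m v^H).
have Ph : P^H = P.
  by rewrite adjmxB adjmx1 adjmxZ adj_rank1 geC0_conj // invr_ge0 ltW.
have Pv : P *m v = 0.
  rewrite mulmxBl mul1mx -scalemxAl mulmx_gram -/N scalerA mulVf ?gt_eqF //.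
  by rewrite scale1r subrr.
have PA p (A : 'M[C]_(p, n.+1)) : A *m v = 0 -> A *m P = A.
  by move=> Av; rewrite mulmxBr mulmx1 -scalemxAr mulmxA Av mul0mx scaler0 subr0.
have PP : P^H *m P = P by rewrite Ph PA.
have [|L EL] := psd_factor_singular _ v0 Pv; first by rewrite -PP; apply: psd_gram.
exists L => A Av Av'; rewrite adjmxK !mulmxA -EL -!mulmxA -EL.
by rewrite PA // -{1}Ph -[A in RHS]adjmxK -adjmxM PA // adjmxK.
Qed.

(* If A v = 0 then B v = B* v = 0 too, and subtracting the product matrix
   |1><1| (x) D v v* D / (v* D v) confines the triple to the complement of v. When
   v* D v = 0 the junk value 0^-1 = 0 is right, because D v = 0. *)
Lemma sep2_split n (A B D : 'M[C]_n.+1) (v : 'cV[C]_n.+1) :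
  (forall A B D : 'M[C]_n, ppt2 A B D -> sep2 A B D) ->
  ppt2 A B D -> v != 0 -> A *m v = 0 -> sep2 A B D.
Proof.
move=> IH pABD v0 Av; have [Bv Bv'] := ppt2_kerA pABD Av.
have hA := ppt2_hermA pABD; have hD := ppt2_hermD pABD; have pD := ppt2_psdD pABD.
pose w := D *m v; pose c := (v^H *m D *m v) 0 0.
have c0 : 0 <= c by case: pD => _ /(_ v).
have wE : w^H = v^H *m D by rewrite adjmxM hD.
pose D' := D - c^-1 *: (w *m w^H).
have D'v : D' *m v = 0.
  rewrite mulmxBl -scalemxAl -/w mulmx_gram wE -/c scalerA.
  have [cz|cz] := eqVneq c 0; last by rewrite mulVf // scale1r subrr.
  by rewrite /w (psd_kernel pD) // scaler0 subr0.
have hD' : D'^H = D'.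
  by rewrite adjmxB adjmxZ adj_rank1 hD geC0_conj // invr_ge0.
have pABD' : ppt2 A B D'.
  (* The congruence by diag(1, Q) fixes [B] and [B^H], which kill v, and takes [D] to [D'], so the
     PPT property is inherited. *)
  pose Q := 1%:M - c^-1 *: (v *m w^H).
  have XQ (X : 'M[C]_n.+1) : X *m v = 0 -> X *m Q = X.
    by move=> Xv; rewrite mulmxBr mulmx1 -scalemxAr mulmxA Xv mul0mx scaler0 subr0.
  have QX (X : 'M[C]_n.+1) : X^H *m v = 0 -> Q^H *m X = X.
    by move=> Xv; rewrite -[X in LHS]adjmxK -adjmxM XQ // adjmxK.
  have QD : Q^H *m D = D'.
    rewrite adjmxB adjmx1 adjmxZ adjmxM adjmxK mulmxBl mul1mx -scalemxAl -mulmxA -wE.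
    by rewrite geC0_conj // invr_ge0.
  case: pABD => p q; split; [apply: psd_block_congr p | apply: psd_block_congr q];
  instantiate (1 := block_mx 1%:M 0 0 Q);
  rewrite adjmx_block !adjmx0 !mulmx_block adjmx1 !mul0mx !mulmx0 !mul1mx !mulmx1;
  by rewrite ?addr0 ?add0r ?mul0mx ?add0r ?addr0 QD !XQ ?QX ?adjmxK.
have [L EL] := ortho_projector_factor v0.
have D'v' : D'^H *m v = 0 by rewrite hD'.
have Av' : A^H *m v = 0 by rewrite hA.
have s : sep2 A B D'.
  rewrite (EL _ Av Av') (EL _ Bv Bv') (EL _ D'v D'v'); apply: sep2_congr; apply: IH.
  by have := ppt2_congr L^H pABD'; rewrite adjmxK.
have := sep2_add s (sep2_scale _ (sep2_prod 0 1 w)); move/(_ c^-1).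
by rewrite invr_ge0 c0 !mul0r rmorph1 mulr1 !scale0r !scaler0 !addr0 scale1r subrK; apply.
Qed.

Lemma nonunit_kernel n (M : 'M[C]_n) :
  M \notin unitmx -> exists2 v : 'cV[C]_n, v != 0 & M *m v = 0.
Proof.
rewrite -unitmx_tr -row_free_unit -kermx_eq0 => /rowV0Pn[u /sub_kermxP uM u0].
exists u^T; first by rewrite -trmx0 (inj_eq (@trmx_inj _ _ _)).
by have := congr1 trmx uM; rewrite trmx_mul trmxK trmx0.
Qed.

(** If B is invertible, z = - a works for any eigenvalue a of A B^-1; otherwise v is taken in the
    kernel of B. *)
Lemma square_pencil_kernel n (A B : 'M[C]_n.+1) :
  exists v : 'cV[C]_n.+1, v != 0 /\ (B *m v = 0 \/ exists z, (A + z *: B) *m v = 0).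
Proof.
have [uB|/nonunit_kernel[v v0 Bv]] := boolP (B \in unitmx); last by exists v; split=> //; left.
have [a /eigenvalueP[u ua u0]] := eigenvalue_closed (A *m invmx B) (ltn0Sn n).
have /nonunit_kernel[v v0 Av] : A + (- a) *: B \notin unitmx.
  apply: contraNN u0 => U; rewrite -[u](mulmxK U) mulmxDr -scalemxAr.
  have -> : u *m A = a *: (u *m B) by rewrite -[A](mulmxKV uB) mulmxA ua -scalemxAl.
  by rewrite scaleNr subrr mul0mx.
by exists v; split=> //; right; exists (- a).
Qed.

(** Zero rows, added by the injective [I], reduce this to the square case. For a factor R = [A B],
    such a v gives the product vector (1, z) (x) v, or (0, 1) (x) v, in the kernel of R. *)
Lemma pencil_kernel r n (A B : 'M[C]_(r, n.+1)) : (r <= n.+1)%N ->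
  exists v : 'cV[C]_n.+1, v != 0 /\ (B *m v = 0 \/ exists z, (A + z *: B) *m v = 0).
Proof.
move=> rn; pose I : 'M[C]_(n.+1, r) := pid_mx r.
have IK : pid_mx r *m I = 1%:M :> 'M[C]_r by rewrite mul_pid_mx minnn (minn_idPr rn) pid_mx_1.
have h (M : 'M[C]_(r, n.+1)) v : I *m M *m v = 0 -> M *m v = 0 :> 'cV[C]_r.
  by move=> E; rewrite -[M]mul1mx -IK -!mulmxA (mulmxA I) E mulmx0.
have [v [v0 [E|[z E]]]] := square_pencil_kernel (I *m A) (I *m B).
  by exists v; split=> //; left; apply: h.
by exists v; split=> //; right; exists z; apply: h; rewrite mulmxDr -scalemxAr.
Qed.

End Split.

(** * The extremality argument *)

Section Extremal.
Variable C : numClosedFieldType.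

(** Partial transposition on the M_2 factor. *)
Definition ptr n (M : 'M[C]_(n + n)) : 'M[C]_(n + n) :=
  block_mx (ulsubmx M) (dlsubmx M) (ursubmx M) (drsubmx M).

Lemma ptr_is_linear n : linear (@ptr n).
Proof.
move=> a X Y; rewrite /ptr scale_block_mx add_block_mx.
by congr block_mx; apply/matrixP => i j; rewrite !mxE.
Qed.

HB.instance Definition _ n :=
  GRing.isLinear.Build C 'M[C]_(n + n) 'M[C]_(n + n) _ (@ptr n) (@ptr_is_linear n).

Lemma ptr_adj n (M : 'M[C]_(n + n)) : ptr M^H = (ptr M)^H.
Proof.
rewrite -[M in LHS]submxK adjmx_block /ptr.
by rewrite block_mxKul block_mxKur block_mxKdl block_mxKdr adjmx_block.
Qed.

Lemma ptrK n : involutive (@ptr n).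
Proof. by move=> M; rewrite /ptr block_mxKul block_mxKur block_mxKdl block_mxKdr submxK. Qed.

(** With the pair of unknowns laid out as one row vector, being proportional to (1, 1) becomes a row
    space inclusion. *)
Definition mxpair r1 r2 (X1 : 'M[C]_r1) (X2 : 'M[C]_r2) : 'rV[C]_(r1 * r1 + r2 * r2) :=
  row_mx (mxvec X1) (mxvec X2).

Lemma mxpair_is_linear r1 r2 a X1 X2 Y1 Y2 :
  @mxpair r1 r2 (a *: X1 + Y1) (a *: X2 + Y2) = a *: mxpair X1 X2 + mxpair Y1 Y2.
Proof. by rewrite /mxpair !linearP /= scale_row_mx add_row_mx. Qed.

(** There are r1^2 + r2^2 unknowns and (2n)^2 equations, so the solution space has dimension at
    least 2 and cannot fit in the line spanned by (1, 1). *)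
Lemma ppt_second_solution n r1 r2 (R1 : 'M[C]_(r1, n + n)) (R2 : 'M[C]_(r2, n + n)) :
  ((n + n) * (n + n) + 1 < r1 * r1 + r2 * r2)%N ->
  exists (X1 : 'M[C]_r1) (X2 : 'M[C]_r2), R1^H *m X1 *m R1 = ptr (R2^H *m X2 *m R2) /\
    ~~ (mxpair X1 X2 <= mxpair 1%:M 1%:M)%MS.
Proof.
move=> big; pose F1 := mulmxr R1 \o mulmx R1^H.
pose F2 := @ptr n \o (mulmxr R2 \o mulmx R2^H).
pose K := col_mx (lin_mx F1) (- lin_mx F2).
have : ~~ (kermx K <= mxpair (1%:M : 'M_r1) (1%:M : 'M_r2))%MS.
  apply/negP => /mxrankS; rewrite mxrank_ker => h.
  have := leq_trans h (rank_leq_row _).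
  have := rank_leq_col K; move: (\rank K) => k; lia.
move/row_subPn => [i ni].
have /sub_kermxP : (row i (kermx K) <= kermx K)%MS by apply: row_sub.
move: (row i (kermx K)) ni => u; rewrite -[u]hsubmxK.
rewrite -[lsubmx u]vec_mxK -[rsubmx u]vec_mxK => ni.
rewrite mul_row_col mulmxN !mul_vec_lin -linearB => /eqP.
rewrite mxvec_eq0 subr_eq0 => /eqP E.
by exists (vec_mx (lsubmx u)), (vec_mx (rsubmx u)).
Qed.

(** Since [ptr] commutes with adjoints, X + X^H and i(X - X^H) are again solutions. Were both on the
    line spanned by (1, 1), so would be their combination X. *)
Lemma ppt_second_hermitian n r1 r2 (R1 : 'M[C]_(r1, n + n)) (R2 : 'M[C]_(r2, n + n)) :
  ((n + n) * (n + n) + 1 < r1 * r1 + r2 * r2)%N ->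
  exists (H1 : 'M[C]_r1) (H2 : 'M[C]_r2), [/\ H1^H = H1, H2^H = H2,
    R1^H *m H1 *m R1 = ptr (R2^H *m H2 *m R2) &
    ~~ (mxpair H1 H2 <= mxpair 1%:M 1%:M)%MS].
Proof.
move=> /(ppt_second_solution R1 R2) [X1 [X2 [E nX]]].
have E' : R1^H *m X1^H *m R1 = ptr (R2^H *m X2^H *m R2).
  by have := congr1 (@adjmx C _ _) E; rewrite -ptr_adj !adjmxM !adjmxK !mulmxA.
have [s|] := boolP (mxpair (X1 + X1^H) (X2 + X2^H) <= mxpair 1%:M 1%:M)%MS; last first.
  exists (X1 + X1^H), (X2 + X2^H); split=> //.
  - by rewrite adjmxD adjmxK addrC.
  - by rewrite adjmxD adjmxK addrC.
  - by rewrite !mulmxDr !mulmxDl E E' linearD.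
exists ('i *: (X1 - X1^H)), ('i *: (X2 - X2^H)); split.
- by rewrite adjmxZ adjmxB adjmxK conjCi scaleNr -scalerN opprB.
- by rewrite adjmxZ adjmxB adjmxK conjCi scaleNr -scalerN opprB.
- by rewrite -!scalemxAr -!scalemxAl !mulmxBr !mulmxBl E E' [RHS]linearZ_LR /= [ptr (_ - _)]linearB.
apply: contraNN nX => t.
have re_im r (X : 'M[C]_r) :
    X = (- (2^-1 * 'i)) *: ('i *: (X - X^H)) + 2^-1 *: (X + X^H).
  rewrite scalerA mulNr -mulrA -expr2 sqrCi mulrN1 opprK -scalerDr addrACA addNr addr0.
  by rewrite -mulr2n -[X *+ 2]scaler_nat scalerA mulVf ?scale1r ?pnatr_eq0.
rewrite (re_im _ X1) (re_im _ X2) mxpair_is_linear addmx_sub ?scalemx_sub //.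
have -> : mxpair (2^-1 *: (X1 + X1^H)) (2^-1 *: (X2 + X2^H)) =
    2^-1 *: mxpair (X1 + X1^H) (X2 + X2^H).
  rewrite -[RHS]addr0 -[2^-1 *: _ in LHS]addr0 -[2^-1 *: (X2 + _)]addr0.
  by rewrite mxpair_is_linear /mxpair !linear0 row_mx0.
by rewrite scalemx_sub.
Qed.

Lemma diag_shift r (P H : 'M[C]_r) d m :
  P^H *m P = 1%:M -> H = P^H *m diag_mx d *m P ->
  m%:M - H = P^H *m diag_mx (const_mx m - d) *m P.
Proof.
move=> PP ->; rewrite linearB /= mulmxBr mulmxBl diag_const_mx mul_mx_scalar.
by rewrite -scalemxAl PP scalemx1.
Qed.

Lemma diag_ge0_factor_lt n m (P : 'M[C]_(n, m)) (d : 'rV[C]_n) (k : 'I_n) :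
  (forall i, 0 <= d 0 i) -> d 0 k = 0 ->
  exists s (R : 'M[C]_(s, m)), P^H *m diag_mx d *m P = R^H *m R /\ (s < n)%N.
Proof.
case: n P d k => [|n] P d k; first by case: k.
by move=> d0 dk; have [R ER] := diag_ge0_factor_singular P d0 dk; exists n, R.
Qed.

(** Here m is the largest entry of the two spectra taken together: both shifts are positive
    semidefinite, and the one whose matrix attains m acquires a zero eigenvalue and loses a row. *)
Lemma max_eigenvalue_shift r1 r2 (H1 : 'M[C]_r1) (H2 : 'M[C]_r2) :
  H1^H = H1 -> H2^H = H2 -> (0 < r1 + r2)%N ->
  exists m s1 s2 (L1 : 'M[C]_(s1, r1)) (L2 : 'M[C]_(s2, r2)),
    [/\ m%:M - H1 = L1^H *m L1, m%:M - H2 = L2^H *m L2 & (s1 + s2 < r1 + r2)%N].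
Proof.
move=> /hermitian_spectral[P1 [d1 [_ U1 E1 re1]]].
move=> /hermitian_spectral[P2 [d2 [_ U2 E2 re2]]] r0.
pose d := row_mx d1 d2; pose k0 := Ordinal r0.
have re i : d 0 i \is Num.real by rewrite mxE; case: fintype.split.
have [k _ dk] : extremum_spec >=%R xpredT (fun i => d 0 i) [arg max_(i > k0) d 0 i]%O.
  by apply: real_arg_maxP => // i _.
pose m := d 0 k.
have d1m i : d1 0 i <= m by have := dk (lshift _ i) isT; rewrite /d row_mxEl.
have d2m i : d2 0 i <= m by have := dk (rshift _ i) isT; rewrite /d row_mxEr.
have e1 i : 0 <= (const_mx m - d1) 0 i by rewrite !mxE subr_ge0.
have e2 i : 0 <= (const_mx m - d2) 0 i by rewrite !mxE subr_ge0.
have [L1 F1] := diag_ge0_factor P1 e1; have [L2 F2] := diag_ge0_factor P2 e2.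
have [j kj|j kj] := split_ordP k.
- have [|s [L [EL sr]]] := diag_ge0_factor_lt P1 (k := j) e1.
    by rewrite !mxE /m /d kj row_mxEl subrr.
  exists m, s, r2, L, L2; split; last by rewrite ltn_add2r.
  + by rewrite -EL -(diag_shift m U1 E1).
  + by rewrite -F2 -(diag_shift m U2 E2).
- have [|s [L [EL sr]]] := diag_ge0_factor_lt P2 (k := j) e2.
    by rewrite !mxE /m /d kj row_mxEr subrr.
  exists m, r1, s, L1, L; split; last by rewrite ltn_add2l.
  + by rewrite -F1 -(diag_shift m U1 E1).
  + by rewrite -EL -(diag_shift m U2 E2).
Qed.

Definition sepM n (T : 'M[C]_(n + n)) := sep2 (ulsubmx T) (ursubmx T) (drsubmx T).

Lemma sepMD n (S T : 'M[C]_(n + n)) : sepM S -> sepM T -> sepM (S + T).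
Proof.
rewrite -[S in X in _ -> _ -> X]submxK -[T in X in _ -> _ -> X]submxK add_block_mx /sepM.
by rewrite block_mxKul block_mxKur block_mxKdr; apply: sep2_add.
Qed.

Lemma sepMZ n c (T : 'M[C]_(n + n)) : 0 <= c -> sepM T -> sepM (c *: T).
Proof.
rewrite -[T in X in _ -> _ -> X]submxK scale_block_mx /sepM.
by rewrite block_mxKul block_mxKur block_mxKdr; apply: sep2_scale.
Qed.

Lemma scalar_mxD r (a b : C) : (a + b)%:M = a%:M + b%:M :> 'M_r.
Proof. exact: raddfD. Qed.

(* R1* H1 R1 = ptr (R2* H2 R2) has more unknowns than equations, so it has a
   Hermitian solution other than the multiples of H1 = 1, H2 = 1. With m the largest
   and - m' the smallest eigenvalue of H1 and H2 together, R1* R1 is a positive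
   multiple of R1* (m - H1) R1 + R1* (m' + H1) R1, where each summand has lower total
   rank. *)
Lemma sepM_extremal_step n r1 r2 (R1 : 'M[C]_(r1, n + n)) (R2 : 'M[C]_(r2, n + n)) :
  (forall s1 s2 (S1 : 'M[C]_(s1, n + n)) (S2 : 'M[C]_(s2, n + n)),
     (s1 + s2 < r1 + r2)%N -> S1^H *m S1 = ptr (S2^H *m S2) -> sepM (S1^H *m S1)) ->
  ((n + n) * (n + n) + 1 < r1 * r1 + r2 * r2)%N ->
  R1^H *m R1 = ptr (R2^H *m R2) -> sepM (R1^H *m R1).
Proof.
move=> IH big E; have [H1 [H2 [h1 h2 EH nH]]] := ppt_second_hermitian R1 R2 big.
have r0 : (0 < r1 + r2)%N by move: big; case: (r1) => [|//]; case: (r2).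
have step (K1 : 'M[C]_r1) (K2 : 'M[C]_r2) : K1^H = K1 -> K2^H = K2 ->
    R1^H *m K1 *m R1 = ptr (R2^H *m K2 *m R2) ->
    exists m, [/\ psd (m%:M - K1), psd (m%:M - K2) & sepM (R1^H *m (m%:M - K1) *m R1)].
  move=> k1 k2 EK; have [m [s1 [s2 [L1 [L2 [F1 F2 lt]]]]]] := max_eigenvalue_shift k1 k2 r0.
  exists m; split; rewrite ?F1 ?F2; [exact: psd_gram|exact: psd_gram|].
  have -> : R1^H *m (L1^H *m L1) *m R1 = (L1 *m R1)^H *m (L1 *m R1).
    by rewrite adjmxM !mulmxA.
  apply: (IH _ _ _ (L2 *m R2)) => //; rewrite !adjmxM.
  have -> : R1^H *m L1^H *m (L1 *m R1) = R1^H *m (m%:M - K1) *m R1 by rewrite F1 !mulmxA.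
  have -> : R2^H *m L2^H *m (L2 *m R2) = R2^H *m (m%:M - K2) *m R2 by rewrite F2 !mulmxA.
  rewrite !mulmxBr !mulmxBl EK !mul_mx_scalar -!scalemxAl E [RHS]linearB /=.
  by rewrite [ptr (m *: _)]linearZ_LR.
have [m [p1 p2 sp]] := step _ _ h1 h2 EH.
have [|||m' [q1 q2 sq]] := step (- H1) (- H2); rewrite ?adjmxN ?h1 ?h2 //.
  by rewrite !mulmxN !mulNmx EH [RHS]linearN.
have ps1 : psd ((m + m')%:M : 'M[C]_r1).
  by have := psdD p1 q1; rewrite opprK addrACA addNr addr0 -scalar_mxD.
have ps2 : psd ((m + m')%:M : 'M[C]_r2).
  by have := psdD p2 q2; rewrite opprK addrACA addNr addr0 -scalar_mxD.
have mm0 : 0 <= m + m'.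
  have diag r (X : 'M[C]_r) i : psd X -> 0 <= X i i.
    case=> _ /(_ (delta_mx i 0)); rewrite -mulmxA -colE !mxE (bigD1 i) //= big1 => [|j /negPf ji].
      by rewrite !mxE !eqxx rmorph1 mul1r addr0.
    by rewrite !mxE ji rmorph0 mul0r.
  case: r1 r2 ps1 ps2 r0 {IH big R1 R2 E H1 H2 h1 h2 EH nH step p1 p2 sp q1 q2 sq}
    => [|r1] [|r2] // p q _.
  - by have := diag _ _ ord0 q; rewrite !mxE eqxx mulr1n.
  - by have := diag _ _ ord0 p; rewrite !mxE eqxx mulr1n.
  - by have := diag _ _ ord0 p; rewrite !mxE eqxx mulr1n.
(* If m + m' = 0, then m - H and H - m are both positive semidefinite, so H1 and H2 equal the same
   scalar m, against their independence of (1, 1). *)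
have {}mm0 : 0 < m + m'.
  rewrite lt_def mm0 andbT; apply: contraNneq nH => /eqP; rewrite addr_eq0 => /eqP mE.
  have hm r (X : 'M[C]_r) : psd (m%:M - X) -> psd (m'%:M - - X) -> X = m *: 1%:M + 0.
    move=> p q; rewrite addr0 scalemx1; apply/eqP; rewrite eq_sym -subr_eq0; apply/eqP.
    apply: psd_antisym => //; rewrite opprB; suff <- : m'%:M - - X = X - m%:M by [].
    by rewrite opprK addrC mE; apply/matrixP => i j; rewrite !mxE mulNrn opprK.
  rewrite (hm _ _ p1 q1) (hm _ _ p2 q2) mxpair_is_linear /mxpair !linear0 row_mx0 addr0.
  by rewrite scalemx_sub.
have -> : R1^H *m R1 = (m + m')^-1 *:
    (R1^H *m (m%:M - H1) *m R1 + R1^H *m (m'%:M - - H1) *m R1).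
  rewrite opprK -mulmxDl -mulmxDr addrACA addNr addr0 -scalar_mxD mul_mx_scalar -scalemxAl.
  by rewrite scalerA mulVf ?scale1r ?gt_eqF.
by apply: sepMZ; [rewrite invr_ge0 ltW|apply: sepMD].
Qed.

End Extremal.

(** * Ranks (4, 4) in dimension 2 x 3 *)

Section NormalDilation.
Variable C : numClosedFieldType.

(** For squared moduli of matrix entries. The relations give (a - h)(b - h) = 0 and (a - h)(a + b) =
    0; if a differed from h, then a = b = 0 and so h = 0 = a. *)
Lemma eq_norms_of_products (a b c h : C) :
  0 <= a -> 0 <= b -> 0 <= c -> 0 <= h ->
  a * c = b * h -> a * b = c * h -> a + b = c + h -> a = h /\ b = c.
Proof.
move=> a0 b0 c0 h0 e1 e2 e3.
have t1 : (a - h) * (b - h) = 0.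
  have -> : (a - h) * (b - h) = a * b - c * h + h * ((c + h) - (a + b)) by ring.
  by rewrite e2 e3 !subrr mulr0 addr0.
have t2 : (a - h) * (a + b) = 0.
  have -> : (a - h) * (a + b) = (a * c - b * h) - a * ((c + h) - (a + b)) by ring.
  by rewrite e1 e3 !subrr mulr0 subr0.
suff ah : a = h by split=> //; apply: (addrI a); rewrite e3 addrC ah.
apply/eqP; rewrite -subr_eq0; apply/negPn/negP => n0.
move/eqP: t2; rewrite mulf_eq0 (negPf n0) /= paddr_eq0 // => /andP[/eqP az /eqP bz].
by move/eqP: t1 n0; rewrite bz az !sub0r mulf_eq0 orbb => ->.
Qed.

(** By Vieta p is a root of (X - r)(X - s), and p != r leaves only s. *)
Lemma eq_of_sum_prod (p q r s : C) : p * q = r * s -> p + q = r + s -> p != r -> p = s /\ q = r.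
Proof.
move=> e1 e2 pr; have : (p - r) * (p - s) = 0.
  have -> : (p - r) * (p - s) = (r * s - p * q) + p * ((p + q) - (r + s)) by ring.
  by rewrite e1 e2 !subrr mulr0 addr0.
move/eqP; rewrite mulf_eq0 subr_eq0 (negPf pr) /= subr_eq0 => /eqP ps; split=> //.
by apply: (addrI p); rewrite e2 ps addrC.
Qed.

Lemma phase_exists (a b : C) : a * a^* = b * b^* -> exists w, w * w^* = 1 /\ w * a = b.
Proof.
have [-> |a0 E] := eqVneq a 0.
  rewrite mul0r => /esym/eqP; rewrite mul_conjC_eq0 => /eqP ->.
  by exists 1; rewrite rmorph1 mulr1 mulr0.
have a0' : a^* != 0 by rewrite conjC_eq0.
exists (b / a); rewrite rmorphM fmorphV /= divfK //; split=> //.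
by rewrite mulrACA -E -invfM divff // mulf_neq0.
Qed.

Lemma sep2_sum I (r : seq I) n (F G H : I -> 'M[C]_n) :
  (forall i, sep2 (F i) (G i) (H i)) ->
  sep2 (\sum_(i <- r) F i) (\sum_(i <- r) G i) (\sum_(i <- r) H i).
Proof. by move=> h; elim/big_rec3: _ => [|i x y z _]; [exact: sep2_0|exact: sep2_add]. Qed.

(** The i-th row of V contributes the product of the qubit vector (1, conj d_i) with the adjoint of
    that row. *)
Lemma sep2_diag m n (V : 'M[C]_(m, n)) (d : 'rV[C]_m) :
  sep2 (V^H *m V) (V^H *m diag_mx d *m V)
       (V^H *m (diag_mx d *m (diag_mx d)^H) *m V).
Proof.
have -> : V^H *m V = V^H *m diag_mx (const_mx 1) *m V by rewrite diag_const_mx mulmx1.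
rewrite diag_mxC_conj mulmx_diag !mulmx_diag_sum; apply: sep2_sum => i; rewrite !mxE.
by have := sep2_prod 1 (d 0 i)^* (row i V)^H; rewrite adjmxK conjCK rmorph1 !mul1r mulrC.
Qed.

(** Lets any of the three indices play the distinguished role [k] without a case analysis in the
    later computations. *)
Lemma ord3_split (k : 'I_3) : exists i j : 'I_3,
  [/\ forall (V : zmodType) (F : 'I_3 -> V), \sum_t F t = F i + F j + F k,
      forall P : 'I_3 -> Prop, P i -> P j -> P k -> forall t, P t & (i == j) = false].
Proof.
pose o0 : 'I_3 := 0; pose o1 : 'I_3 := 1; pose o2 : 'I_3 := 2%:R.
have sE (V : zmodType) (F : 'I_3 -> V) : \sum_t F t = F o0 + F o1 + F o2.
  rewrite !big_ord_recl big_ord0 addr0 addrA.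
  by do 2?congr (_ + _); congr F; apply/val_inj.
have cE (t : 'I_3) : t = o0 \/ t = o1 \/ t = o2.
  by case: t => [[|[|[|//]]] ?]; [left|right; left|right; right]; apply/val_inj.
case: (cE k) => [|[|]] ->; [exists o1, o2|exists o0, o2|exists o0, o1]; split=> //;
  try by move=> P ? ? ? t; case: (cE t) => [|[|]] ->.
- by move=> V F; rewrite sE -addrA addrC.
- by move=> V F; rewrite sE addrAC.
Qed.

(** The first n columns V of the diagonalising unitary satisfy V^H V = 1, and compressing the
    spectral decompositions of N and N N^H by V gives the form of [sep2_diag]. *)
Lemma sep2_normal_dilation n p (N : 'M[C]_(n + p)) : N *m N^H = N^H *m N ->
  sep2 1%:M (ulsubmx N) (ulsubmx (N *m N^H)).
Proof.
case/normal_spectral => P [d [P1 P2 E]]; pose V := lsubmx P.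
have ulE D : ulsubmx (P^H *m D *m P) = V^H *m D *m V.
  rewrite -[P]hsubmxK adjmx_row -mulmxA mul_mx_row mul_col_row -/V.
  by rewrite /block_mx /ulsubmx col_mxKu row_mxKl mulmxA.
have -> : 1%:M = V^H *m V.
  have := ulE 1%:M; rewrite !mulmx1 P2 => <-.
  by apply/matrixP => i j; rewrite !mxE; congr (_%:R); rewrite (inj_eq (@lshift_inj _ _)).
have -> : N *m N^H = P^H *m (diag_mx d *m (diag_mx d)^H) *m P.
  rewrite E !adjmxM adjmxK !mulmxA; congr (_ *m _ *m _).
  by rewrite -mulmxA P1 mulmx1.
by rewrite E !ulE; apply: sep2_diag.
Qed.

(** Cyclicity of the trace: tr([B, B^H] M) = 0 whenever M commutes with B. *)
Lemma trace_comm_diag (B : 'M[C]_3) (x : 'rV[C]_3) (M : 'M[C]_3) :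
  B *m B^H - B^H *m B = diag_mx x -> B *m M = M *m B -> \sum_t x 0 t * M t t = 0.
Proof.
move=> E BM; transitivity (\tr (diag_mx x *m M)).
  by apply: eq_bigr => t _; rewrite mul_diag_mx !mxE.
rewrite -E mulmxBl raddfB /= mxtrace_mulC mulmxA -BM mxtrace_mulC !mulmxA.
by rewrite mxtrace_mulC mulmxA subrr.
Qed.

(** The system is real-linear in f. Pairing it with d gives f m - conj(f) g = s; pairing with e
    gives minus the conjugate of this equation, by the second hypothesis. *)
Lemma conj_linear_solve (d1 d2 e1 e2 w1 w2 : C) :
  d1 * d1^* + d2 * d2^* = e1 * e1^* + e2 * e2^* ->
  e1^* * w1 + e2^* * w2 = - (d1^* * w1 + d2^* * w2)^* ->
  d1 * e2 - d2 * e1 != 0 ->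
  exists f, w1 = f * d1 - f^* * e1 /\ w2 = f * d2 - f^* * e2.
Proof.
move=> em ew D0; set D := d1 * e2 - d2 * e1 in D0.
have D0' : D^* != 0 by rewrite conjC_eq0.
set m := d1 * d1^* + d2 * d2^* in em; pose g := d1^* * e1 + d2^* * e2.
pose s := d1^* * w1 + d2^* * w2.
have gc : g^* = d1 * e1^* + d2 * e2^* by rewrite /g rmorphD !rmorphM /= !conjCK.
have Dc : D^* = d1^* * e2^* - d2^* * e1^* by rewrite /D rmorphB !rmorphM.
have mc : m^* = m by rewrite /m rmorphD !rmorphM /= !conjCK; congr (_ + _); rewrite mulrC.
have DD : D * D^* = m * m - g * g^* by rewrite {2}em gc Dc /D /m /g; ring.
(* Eliminates conj(f) between f m - conj(f) g = s and its conjugate; the denominator is m^2 - |g|^2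
   = |D|^2, the Lagrange identity. *)
pose f := (m * s + g * s^*) / (D * D^*).
have fE : f * (D * D^*) = m * s + g * s^* by rewrite divfK // mulf_neq0.
have fcE : f^* * (D * D^*) = m * s^* + g^* * s.
  have conjE (x y z t : C) : (x * y + z * t^*)^* = x^* * y^* + z^* * t.
    by rewrite rmorphD !rmorphM /= conjCK.
  have <- : (f * (D * D^*))^* = f^* * (D * D^*).
    have conjE2 (x y : C) : (x * (y * y^*))^* = x^* * (y * y^*).
      by rewrite !rmorphM /= conjCK [y^* * y]mulrC.
    exact: conjE2.
  by rewrite fE conjE mc.
(* The residual (z1, z2) is orthogonal to d and to e, which are independent because [D] is
   nonzero. *)
clearbody f; exists f; pose z1 := w1 - (f * d1 - f^* * e1); pose z2 := w2 - (f * d2 - f^* * e2).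
have DDnz : D * D^* != 0 by rewrite mulf_neq0.
have dz : d1^* * z1 + d2^* * z2 = 0.
  have -> : d1^* * z1 + d2^* * z2 = s - f * m + f^* * g by rewrite /z1 /z2 /s /m /g; ring.
  apply: (mulIf DDnz); rewrite mul0r.
  have -> : (s - f * m + f^* * g) * (D * D^*) =
     s * (D * D^*) - (f * (D * D^*)) * m + (f^* * (D * D^*)) * g by ring.
  by rewrite fE fcE DD; ring.
have ez : e1^* * z1 + e2^* * z2 = 0.
  have -> : e1^* * z1 + e2^* * z2 =
     (e1^* * w1 + e2^* * w2) - f * (d1 * e1^* + d2 * e2^*) + f^* * (e1 * e1^* + e2 * e2^*).
    by rewrite /z1 /z2; ring.
  rewrite ew -em -gc -/s; apply: (mulIf DDnz); rewrite mul0r.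
  have -> : (- s^* - f * g^* + f^* * m) * (D * D^*) =
     - s^* * (D * D^*) - (f * (D * D^*)) * g^* + (f^* * (D * D^*)) * m by ring.
  by rewrite fE fcE DD; ring.
have z10 : z1 = 0.
  apply: (mulfI D0'); rewrite mulr0 Dc.
  have -> : (d1^* * e2^* - d2^* * e1^*) * z1 =
     e2^* * (d1^* * z1 + d2^* * z2) - d2^* * (e1^* * z1 + e2^* * z2) by ring.
  by rewrite dz ez !mulr0 subr0.
have z20 : z2 = 0.
  apply: (mulfI D0'); rewrite mulr0 Dc.
  have -> : (d1^* * e2^* - d2^* * e1^*) * z2 =
     d1^* * (e1^* * z1 + e2^* * z2) - e1^* * (d1^* * z1 + d2^* * z2) by ring.
  by rewrite dz ez !mulr0 subr0.
by split; apply/eqP; rewrite -subr_eq0; apply/eqP.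
Qed.

(* Makes [[B, e'], [d*, f]] normal. In an eigenbasis of X = dd* - ee*, with
   eigenvectors i, j, k for mu, - mu, 0, the traces of X B and X B^2 vanish; with the
   entries (i, j) and (k, k) of BB* - B*B = X this forces |B_ik| = |B_kj| and
   |B_jk| = |B_ki|. Hence |(B* e)_k| = |(B d)_k|, the phase of e can be chosen to make
   them equal, and f solves a linear system in the span of i and j. *)
Lemma normal_completion (B : 'M[C]_3) (d e : 'cV[C]_3) (x : 'rV[C]_3) :
  B *m B^H - B^H *m B = diag_mx x -> d *m d^H - e *m e^H = diag_mx x -> x != 0 ->
  exists e' f, [/\ e' *m e'^H = e *m e^H, d^H *m d = e'^H *m e' &
    B *m d - B^H *m e' = f *: d - f^* *: e'].
Proof.
move=> EB Ed x0.
(* A vector orthogonal to d and e is killed by [diag_mx x], so x vanishes at any index k where v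
   does not; this provides the eigenvalue 0. *)
have [v [v0 vd ve]] : exists v : 'cV[C]_3, [/\ v != 0, d^H *m v = 0 & e^H *m v = 0].
  have : kermx (row_mx d e) != 0.
    by rewrite -mxrank_eq0 mxrank_ker -lt0n subn_gt0 ltnS rank_leq_col.
  move=> /rowV0Pn[u /sub_kermxP ud u0]; exists u^H; split.
  - by apply: contraNneq u0 => u0; rewrite -[u]adjmxK u0 adjmx0.
  - by move: ud; rewrite mul_mx_row -row_mx0 => /eq_row_mx[ud _]; rewrite -adjmxM ud adjmx0.
  - by move: ud; rewrite mul_mx_row -row_mx0 => /eq_row_mx[_ ue]; rewrite -adjmxM ue adjmx0.
have [k vk] : exists k, v k 0 != 0.
  apply/existsP; apply: contraNT v0 => /existsPn h; apply/eqP/colP => t.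
  by rewrite mxE; apply/eqP/negPn/h.
have xv t : x 0 t * v t 0 = 0.
  have : diag_mx x *m v = 0 by rewrite -Ed mulmxBl -!mulmxA vd ve !mulmx0 subr0.
  by move/colP/(_ t); rewrite mul_diag_mx !mxE.
have xk : x 0 k = 0 by move/eqP: (xv k); rewrite mulf_eq0 (negPf vk) orbF => /eqP.
have [i [j [sE allE ij]]] := ord3_split k.
have sx : x 0 i + x 0 j = 0.
  have := trace_comm_diag (M := 1%:M) EB; rewrite mulmx1 mul1mx sE xk => /(_ erefl).
  by rewrite !mxE !eqxx !mulr1n !mulr1 addr0.
have xi : x 0 i != 0.
  apply: contraNneq x0 => xi; apply/eqP/rowP => t; rewrite mxE; move: t; apply: allE => //.
  by move: sx; rewrite xi add0r.
have xj : x 0 j = - x 0 i by apply/eqP; rewrite -addr_eq0 addrC sx.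
have xj0 : x 0 j != 0 by rewrite xj oppr_eq0.
have vi : v i 0 = 0 by move/eqP: (xv i); rewrite mulf_eq0 (negPf xi) => /eqP.
have vj : v j 0 = 0 by move/eqP: (xv j); rewrite mulf_eq0 (negPf xj0) => /eqP.
have dk : d k 0 = 0.
  move/matrixP/(_ 0 0): vd; rewrite !mxE sE vi vj !mulr0 !add0r !mxE => /eqP.
  by rewrite mulf_eq0 (negPf vk) orbF conjC_eq0 => /eqP.
have ek : e k 0 = 0.
  move/matrixP/(_ 0 0): ve; rewrite !mxE sE vi vj !mulr0 !add0r !mxE => /eqP.
  by rewrite mulf_eq0 (negPf vk) orbF conjC_eq0 => /eqP.
pose b s t := B s t.
have comm s t : \sum_r (b s r * (b t r)^*) - \sum_r ((b r s)^* * b r t) = x 0 s *+ (s == t).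
  have /matrixP/(_ s t) := EB; rewrite !mxE => <-.
  by congr (_ - _); apply: eq_bigr => r _; rewrite !mxE.
have de s t : d s 0 * (d t 0)^* - e s 0 * (e t 0)^* = x 0 s *+ (s == t).
  have /matrixP/(_ s t) := Ed; rewrite !mxE => <-.
  by rewrite !big_ord1 !mxE.
have bii : b i i = b j j.
  have := trace_comm_diag EB (erefl (B *m B)); rewrite sE xk xj mul0r addr0 mulNr -mulrBr.
  move/eqP; rewrite mulf_eq0 (negPf xi) /= subr_eq0 => /eqP; exact.
have B2 t : (B *m B) t t = b t i * b i t + b t j * b j t + b t k * b k t by rewrite mxE sE.
have b2 : b i k * b k i = b j k * b k j.
  have := trace_comm_diag EB (mulmxA B B B); rewrite sE xk xj mul0r addr0 mulNr -mulrBr.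
  move/eqP; rewrite mulf_eq0 (negPf xi) /= !B2 bii => h.
  by apply/eqP; rewrite -subr_eq0; move: h; apply: etrans; congr (_ == _); ring.
have c12 : b i k * (b j k)^* = (b k i)^* * b k j.
  have := comm i j; rewrite ij mulr0n !sE bii => /eqP; rewrite subr_eq0 => /eqP h.
  apply/eqP; rewrite -subr_eq0; move/eqP: h; rewrite -subr_eq0.
  by apply: etrans; congr (_ == _); ring.
have nrm : b i k * (b i k)^* + b j k * (b j k)^* = b k i * (b k i)^* + b k j * (b k j)^*.
  have := comm k k; rewrite eqxx mulr1n !sE xk => /eqP; rewrite subr_eq0 => /eqP h.
  apply/eqP; rewrite -subr_eq0; move/eqP: h; rewrite eq_sym -subr_eq0.
  by apply: etrans; congr (_ == _); ring.
have dij : d i 0 * (d j 0)^* = e i 0 * (e j 0)^*.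
  by have := de i j; rewrite ij mulr0n => /eqP; rewrite subr_eq0 => /eqP.
have dsum : d i 0 * (d i 0)^* + d j 0 * (d j 0)^* = e i 0 * (e i 0)^* + e j 0 * (e j 0)^*.
  have := de i i; have := de j j; rewrite !eqxx !mulr1n => hj hi.
  apply/eqP; rewrite -subr_eq0 -sx -hi -hj; apply/eqP; ring.
have dine : d i 0 * (d i 0)^* != e i 0 * (e i 0)^*.
  by rewrite -subr_eq0 de eqxx mulr1n.
have ge0 (z : C) : 0 <= z * z^* by exact: mul_conjC_ge0.
have [nh nc] : b i k * (b i k)^* = b k j * (b k j)^* /\ b j k * (b j k)^* = b k i * (b k i)^*.
  apply: eq_norms_of_products => //.
  - have := congr2 *%R b2 (congr1 Num.conj b2); rewrite !rmorphM /= => h.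
    by transitivity ((b i k * b k i) * ((b i k)^* * (b k i)^*)); [ring|rewrite h; ring].
  - have := congr2 *%R c12 (congr1 Num.conj c12); rewrite !rmorphM /= !conjCK => h.
    by transitivity ((b i k * (b j k)^*) * ((b i k)^* * b j k)); [ring|rewrite h; ring].
(* The pairs of squared moduli of d and of e on {i, j} have equal sum and product, and differ at i,
   so they are swapped. *)
have [ds dr] : d i 0 * (d i 0)^* = e j 0 * (e j 0)^* /\ d j 0 * (d j 0)^* = e i 0 * (e i 0)^*.
  apply: eq_of_sum_prod dsum dine.
  have := congr2 *%R dij (congr1 Num.conj dij); rewrite !rmorphM /= !conjCK => h.
  by transitivity ((d i 0 * (d j 0)^*) * ((d i 0)^* * d j 0)); [ring|rewrite h; ring].
have [w [w1 wE]] : exists w, w * w^* = 1 /\ w * (B^H *m e) k 0 = (B *m d) k 0.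
  apply: phase_exists; rewrite !mxE !sE dk ek !mulr0 !addr0 !mxE -!/(b _ _).
  have cc : (b i k)^* * b j k = b k i * (b k j)^*.
    by have := congr1 Num.conj c12; rewrite !rmorphM /= !conjCK.
  have dc : (d i 0)^* * d j 0 = (e i 0)^* * e j 0.
    by have := congr1 Num.conj dij; rewrite !rmorphM /= !conjCK.
  rewrite !rmorphD !rmorphM /= !conjCK.
  transitivity ((b i k * (b i k)^*) * (e i 0 * (e i 0)^*)
     + (b j k * (b j k)^*) * (e j 0 * (e j 0)^*)
     + ((b i k)^* * b j k) * (e i 0 * (e j 0)^*)
     + (b i k * (b j k)^*) * ((e i 0)^* * e j 0)); first by ring.
  by rewrite nh nc cc c12 -dij -dc -ds -dr; ring.
pose e' := w *: e.
have e'E s t : e' s 0 * (e' t 0)^* = e s 0 * (e t 0)^*.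
  by rewrite !mxE rmorphM mulrACA w1 mul1r.
have e'k : e' k 0 = 0 by rewrite mxE ek mulr0.
have Wk : (B *m d - B^H *m e') k 0 = 0.
  by rewrite mxE [(- _ : 'M_(_, _)) _ _]mxE -scalemxAr [(w *: _ : 'M_(_, _)) _ _]mxE wE subrr.
clearbody e'.
have bs : d i 0 * (d i 0)^* + d j 0 * (d j 0)^* = e' i 0 * (e' i 0)^* + e' j 0 * (e' j 0)^*.
  by rewrite !e'E.
have dij' : d i 0 * (d j 0)^* = e' i 0 * (e' j 0)^* by rewrite e'E.
have [||f [f1 f2]] := @conj_linear_solve (d i 0) (d j 0) (e' i 0) (e' j 0)
    ((B *m d - B^H *m e') i 0) ((B *m d - B^H *m e') j 0) bs.
- have WE s : (B *m d - B^H *m e') s 0 =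
      b s i * d i 0 + b s j * d j 0 - ((b i s)^* * e' i 0 + (b j s)^* * e' j 0).
    by rewrite mxE [(- _ : 'M_(_, _)) _ _]mxE !mxE !sE dk e'k !mulr0 !addr0 !mxE.
  apply/eqP; rewrite -subr_eq0 opprK !WE bii; apply/eqP.
  rewrite !(rmorphD, rmorphN, rmorphM) /= !conjCK.
  have dc : (d i 0)^* * d j 0 = (e' i 0)^* * e' j 0.
    by have := congr1 Num.conj dij'; rewrite !rmorphM /= !conjCK.
  transitivity ((b j j)^* * ((d i 0 * (d i 0)^* + d j 0 * (d j 0)^*)
      - (e' i 0 * (e' i 0)^* + e' j 0 * (e' j 0)^*))
    + (b i j)^* * (d i 0 * (d j 0)^* - e' i 0 * (e' j 0)^*)
    + (b j i)^* * ((d i 0)^* * d j 0 - (e' i 0)^* * e' j 0)); first by ring.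
  by rewrite bs dij' dc !subrr !mulr0 !addr0.
(* A zero determinant together with the swap of moduli gives |d_i|^4 = |d_j|^4, hence |d_i| = |d_j|
   = |e_i|, which is excluded. *)
- apply: contraNneq dine => /eqP; rewrite subr_eq0 => /eqP h.
  rewrite -dr -(eqrXn2 (n := 2)) // !expr2 {1}ds -{1}[e j 0 * _]e'E.
  rewrite [X in _ == _ * X]dr -[e i 0 * _]e'E.
  have := congr2 *%R h (congr1 Num.conj h); rewrite !rmorphM /= => hh.
  by apply/eqP; transitivity (d i 0 * e' j 0 * ((d i 0)^* * (e' j 0)^*)); [ring|rewrite hh; ring].
exists e', f; split.
- apply/matrixP => s t; rewrite ![(_ *m _) s t]mxE !big_ord1.
  by rewrite ![_^H _ _]mxE ![map_mx _ _ _ _]mxE e'E.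
- apply/matrixP => s t; rewrite !ord1 !mxE !sE dk e'k !mulr0 !addr0 ![_^H _ _]adjmxE.
  by rewrite ![_^* * _]mulrC bs.
- apply/colP; apply: allE.
  + by rewrite f1 !mxE.
  + by rewrite f2 !mxE.
  + rewrite Wk [RHS]mxE [(- _ : 'M_(_, _)) _ _]mxE.
    by rewrite ![(_ *: _ : 'M_(_, _)) _ _]mxE dk e'k !mulr0 subrr.
Qed.

(** After rotation to an eigenbasis of dd^H - ee^H: if this difference is 0, B is normal and dd^H is
    added as a product matrix; otherwise [normal_completion] gives a normal 4 x 4 dilation N of B
    such that N N^H has corner D. *)
Lemma sep2_identity (B D : 'M[C]_3) (d e : 'cV[C]_3) :
  D = B^H *m B + d *m d^H -> D = B *m B^H + e *m e^H -> sep2 1%:M B D.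
Proof.
move=> D1 D2; have XE : d *m d^H - e *m e^H = B *m B^H - B^H *m B.
  by rewrite -[d *m d^H](addKr (B^H *m B)) -D1 D2 addrA addrK addrC.
have [|P [x [P1 P2 EX _]]] := @hermitian_spectral C 3 (d *m d^H - e *m e^H).
  by rewrite adjmxB !adj_rank1.
have conjP M N : P *m (M *m N) *m P^H = (P *m M *m P^H) *m (P *m N *m P^H).
  by rewrite !mulmxA -(mulmxA (P *m M) P^H) P2 mulmx1.
suff s : sep2 1%:M (P *m B *m P^H) (P *m D *m P^H).
  have := sep2_congr P^H s; rewrite adjmxK mulmx1 P2.
  have K M : P^H *m (P *m M *m P^H) *m P = M.
    by rewrite !mulmxA P2 mul1mx -mulmxA P2 mulmx1.
  by rewrite !K.
have EX' : P *m (d *m d^H - e *m e^H) *m P^H = diag_mx x.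
  by rewrite EX !mulmxA P1 mul1mx -mulmxA P1 mulmx1.
have dP (v : 'cV_3) : P *m (v *m v^H) *m P^H = (P *m v) *m (P *m v)^H.
  by rewrite adjmxM !mulmxA.
have hP : (P *m B *m P^H)^H = P *m B^H *m P^H by rewrite !adjmxM adjmxK mulmxA.
have E1 : (P *m B *m P^H) *m (P *m B *m P^H)^H - (P *m B *m P^H)^H *m (P *m B *m P^H) = diag_mx x.
  by rewrite hP -!conjP -EX' XE mulmxBr mulmxBl.
have E2 : (P *m d) *m (P *m d)^H - (P *m e) *m (P *m e)^H = diag_mx x.
  by rewrite -EX' mulmxBr mulmxBl !dP.
have D1' : P *m D *m P^H = (P *m B *m P^H)^H *m (P *m B *m P^H) + (P *m d) *m (P *m d)^H.
  by rewrite D1 mulmxDr mulmxDl hP -conjP dP.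
have D2' : P *m D *m P^H = (P *m B *m P^H) *m (P *m B *m P^H)^H + (P *m e) *m (P *m e)^H.
  by rewrite D2 mulmxDr mulmxDl hP -conjP dP.
move: (P *m B *m P^H) (P *m d) (P *m e) (P *m D *m P^H) E1 E2 D1' D2'.
move=> {XE EX EX' hP dP conjP D1 D2} {}B {}d {}e {}D E1 E2 D1 D2.
have [x0|x0] := eqVneq x 0.
  have := @sep2_normal_dilation 3 1 (block_mx B 0 0 0).
  rewrite adjmx_block !adjmx0 !mulmx_block !mulmx0 !mul0mx !addr0 !block_mxKul.
  move/eqP: E1; rewrite x0 linear0 subr_eq0 => /eqP ->; move/(_ erefl) => s.
  have := sep2_add s (sep2_prod 0 1 d).
  by rewrite !mul0r conjC1 mulr1 !scale0r scale1r !addr0 -D1.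
have [e' [f [ee de w]]] := normal_completion E1 E2 x0.
have := @sep2_normal_dilation 3 1 (block_mx B e' d^H f%:M).
rewrite adjmx_block !mulmx_block !adjmxK !block_mxKul ee -D2; apply.
have fE : (f%:M : 'M_1)^H = (f^*)%:M.
  by apply/matrixP => i j; rewrite !mxE !ord1 eqxx !mulr1n.
have offE : B *m d + e' *m (f^*)%:M = B^H *m e' + d *m f%:M.
  rewrite !mul_mx_scalar; apply/eqP; rewrite -subr_eq0 opprD addrACA w.
  by rewrite -[X in _ + X]opprB subrr.
rewrite fE; congr block_mx.
- by rewrite -D1.
- by rewrite offE.
- have := congr1 (@adjmx C _ _) offE; rewrite !adjmxD !adjmxM !adjmxK -fE adjmxK.
  by move=> ->.
- by rewrite de -!scalar_mxM mulrC.
Qed.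

End NormalDilation.

(** * The Stormer-Woronowicz theorem *)

Section StormerWoronowicz.
Variable C : numClosedFieldType.

(** With n + 1 rows the range of the isometry V has a one-dimensional complement, spanned by a unit
    vector g. Then 1 = V V^H + g g^H, and d = W^H g. *)
Lemma isometry_defect n (V W : 'M[C]_(n + 1, n)) : V^H *m V = 1%:M ->
  exists d : 'cV[C]_n, W^H *m W = (V^H *m W)^H *m (V^H *m W) + d *m d^H.
Proof.
move=> VV.
have [g [gV gg]] : exists g : 'cV[C]_(n + 1), V^H *m g = 0 /\ g^H *m g = 1%:M.
  have : kermx V != 0.
    rewrite -mxrank_eq0 mxrank_ker -lt0n subn_gt0.
    by apply: leq_ltn_trans (rank_leq_col V) _; rewrite addn1.
  move=> /rowV0Pn[u /sub_kermxP uV u0].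
  have g0 : u^H != 0 by apply: contraNneq u0 => u0; rewrite -[u]adjmxK u0 adjmx0.
  have N0 := gram_col_gt0 g0; set N := (_ 0 0) in N0.
  exists ((sqrtC N)^-1 *: u^H); split.
    by rewrite -scalemxAr -adjmxM uV adjmx0 scaler0.
  have s0 : 0 <= (sqrtC N)^-1 by rewrite invr_ge0 sqrtC_ge0 ltW.
  rewrite adjmxZ geC0_conj // -scalemxAl -scalemxAr scalerA -expr2 exprVn sqrtCK.
  rewrite [X in _ *: X]mx11_scalar -/N scale_scalar_mx mulVf ?gt_eqF //.
have U : row_mx V g *m (row_mx V g)^H = 1%:M.
  apply: mulmx1C; rewrite adjmx_row mul_col_row VV gV gg.
  have -> : g^H *m V = 0 by rewrite -[V]adjmxK -adjmxM gV adjmx0.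
  by rewrite -scalar_mx_block.
exists (W^H *m g); have -> : W^H *m W = W^H *m (1%:M *m W) by rewrite mul1mx.
by rewrite -U adjmx_row mul_row_col mulmxDl mulmxDr !adjmxM !adjmxK !mulmxA.
Qed.

Lemma gram_row_block m n (V W : 'M[C]_(m, n)) :
  (row_mx V W)^H *m row_mx V W = block_mx (V^H *m V) (V^H *m W) (V^H *m W)^H (W^H *m W).
Proof. by rewrite adjmx_row mul_col_row adjmxM adjmxK. Qed.

(* Normalising A to 1, [R1] and [R2] give D = B*B + dd* = BB* + ee*. *)
Lemma sep2_rank4 (A B D : 'M[C]_3) (R1 R2 : 'M[C]_(3 + 1, 3 + 3)) :
  R1^H *m R1 = block_mx A B B^H D -> R2^H *m R2 = block_mx A B^H B D ->
  A \in unitmx -> sep2 A B D.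
Proof.
rewrite -[R1]hsubmxK -[R2]hsubmxK !gram_row_block.
move: (lsubmx R1) (rsubmx R1) (lsubmx R2) (rsubmx R2) => V1 W1 V2 W2.
move=> /eq_block_mx[EA EB _ ED] /eq_block_mx[EA2 EB2 _ ED2] uA.
have [S AS] : exists S : 'M[C]_3, A = S^H *m S by apply: psd_factor; rewrite -EA; apply: psd_gram.
have uS : S \in unitmx by move: uA; rewrite AS unitmx_mul => /andP[].
pose T := invmx S.
have STM M : S^H *m (T^H *m M *m T) *m S = M.
  by rewrite !mulmxA -adjmxM mulVmx // adjmx1 mul1mx mulmxKV.
have TAT : T^H *m A *m T = 1%:M by rewrite AS mulmxA -adjmxM -mulmxA mulmxV // adjmx1 mulmx1.
have TG m (V W : 'M[C]_(m, 3)) : (V *m T)^H *m (W *m T) = T^H *m (V^H *m W) *m T.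
  by rewrite adjmxM !mulmxA.
have [|d Ed] := @isometry_defect 3 (V1 *m T) (W1 *m T); first by rewrite TG EA TAT.
have [|e Ee] := @isometry_defect 3 (V2 *m T) (W2 *m T); first by rewrite TG EA2 TAT.
rewrite (TG _ V1 W1) (TG _ W1 W1) ED EB in Ed.
rewrite (TG _ V2 W2) (TG _ W2 W2) ED2 EB2 in Ee.
have hB : (T^H *m B^H *m T)^H = T^H *m B *m T by rewrite !adjmxM !adjmxK mulmxA.
have hB' : T^H *m B^H *m T = (T^H *m B *m T)^H by rewrite -hB adjmxK.
rewrite hB hB' in Ee.
have := sep2_congr S^H (sep2_identity Ed Ee); rewrite adjmxK !STM.
by rewrite -TAT STM.
Qed.

Lemma sep2_unshear n l (A B D : 'M[C]_n) : D^H = D ->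
  sep2 (A + l *: B + l^* *: B^H + (l * l^*) *: D) (B + l^* *: D) D -> sep2 A B D.
Proof.
move=> hD /(sep2_shear (- l)); rewrite adjmxD adjmxZ conjCK hD.
by congr (sep2 _ _ _); apply/matrixP => i j; rewrite !mxE rmorphN /=; ring.
Qed.

(** A kernel vector of W, or of V + z W, becomes one of the corner block after a swap, or a shear by
    z, of the qubit basis; [sep2_split] then applies. *)
Lemma sep2_low_rank n r (R : 'M[C]_(r, n.+1 + n.+1)) (A B D : 'M[C]_n.+1) :
  (forall A B D : 'M[C]_n, ppt2 A B D -> sep2 A B D) -> (r <= n.+1)%N ->
  R^H *m R = block_mx A B B^H D -> ppt2 A B D -> sep2 A B D.
Proof.
move=> IH rn ER p; move: ER; rewrite -[R]hsubmxK gram_row_block.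
move: (lsubmx R) (rsubmx R) => V W /eq_block_mx[EA EB _ ED].
have [v [v0 [Wv|[z VWv]]]] := pencil_kernel V W rn.
  rewrite -[B]adjmxK; apply: sep2_swap; apply: (sep2_split IH (ppt2_swap p) v0).
  by rewrite -ED -mulmxA Wv mulmx0.
apply: (@sep2_unshear n.+1 z) (ppt2_hermD p) _.
apply: (sep2_split IH (ppt2_shear z p) v0).
have -> : A + z *: B + z^* *: B^H + (z * z^*) *: D = (V + z *: W)^H *m (V + z *: W).
  rewrite -EA -EB -ED adjmxD adjmxZ adjmxM adjmxK !mulmxDl !mulmxDr.
  by rewrite -!scalemxAl -!scalemxAr !addrA scalerA [z^* * z]mulrC.
by rewrite -mulmxA VWv mulmx0.
Qed.

Lemma psd_block_gram n (S : 'M[C]_(n + n)) : S^H = S ->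
  S = block_mx (ulsubmx S) (ursubmx S) (ursubmx S)^H (drsubmx S).
Proof.
by rewrite -{1 2 3}[S]submxK adjmx_block => /eq_block_mx[_ _ -> _]; rewrite submxK.
Qed.

(** Since 2(n + 1)^2 is 2, 8, 18 against 4n^2 + 1 = 1, 5, 17 for n = 0, 1, 2, only n = 3 can fail,
    where 16 + 16 <= 37 < 16 + 25. *)
Lemma rank_dichotomy n r1 r2 : (n <= 3)%N -> (n < r1)%N -> (n < r2)%N ->
  ((n + n) * (n + n) + 1 < r1 * r1 + r2 * r2)%N \/ [/\ n = 3, r1 = 4 & r2 = 4]%N.
Proof.
move=> n3 h1 h2.
have [lt|] := ltnP ((n + n) * (n + n) + 1) (r1 * r1 + r2 * r2); first by left.
move=> le; right; case: n n3 h1 h2 le => [|[|[|[|//]]]] _ h1 h2 le; try nia.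
have [e1|] := eqVneq r1 4; have [e2|] := eqVneq r2 4; split=> //; nia.
Qed.

(** The outer induction on n serves the splitting of product vectors, the inner one on s1 + s2 the
    extremality step. Row counts of arbitrary factors stand in for ranks. *)
Theorem stormer_woronowicz n (A B D : 'M[C]_n) : (n <= 3)%N -> ppt2 A B D -> sep2 A B D.
Proof.
elim: n A B D => [|n IHn] A B D n3.
  by rewrite [A]flatmx0 [B]flatmx0 [D]flatmx0 => _; apply: sep2_0.
have {}IHn A' B' D' := IHn A' B' D' (ltnW n3).
suff main k s1 s2 (S1 : 'M[C]_(s1, n.+1 + n.+1)) (S2 : 'M[C]_(s2, n.+1 + n.+1)) :
    (s1 + s2 < k)%N -> S1^H *m S1 = ptr (S2^H *m S2) -> sepM (S1^H *m S1).
  case=> /psd_factor[S1 E1] /psd_factor[S2 E2].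
  have := main _ _ _ S1 S2 (ltnSn _); rewrite -E1 -E2 /ptr /sepM.
  by rewrite !block_mxKul !block_mxKur !block_mxKdl !block_mxKdr; apply.
elim: k s1 s2 S1 S2 => // k IHk s1 s2 S1 S2 sk ES.
set T := S1^H *m S1; have hT : T^H = T by case: (psd_gram S1).
have ET : S1^H *m S1 = block_mx (ulsubmx T) (ursubmx T) (ursubmx T)^H (drsubmx T).
  exact: psd_block_gram.
have ET2 : S2^H *m S2 = block_mx (ulsubmx T) (ursubmx T)^H (ursubmx T) (drsubmx T).
  have <- : ptr T = S2^H *m S2 by rewrite /T ES ptrK.
  by rewrite [T in LHS]ET /ptr !block_mxKul !block_mxKur !block_mxKdl !block_mxKdr.
have pT : ppt2 (ulsubmx T) (ursubmx T) (drsubmx T).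
  by split; rewrite -?ET -?ET2; apply: psd_gram.
have [r1|r1] := leqP s1 n.+1; first exact: sep2_low_rank IHn r1 ET pT.
have [r2|r2] := leqP s2 n.+1.
  rewrite /sepM -[ursubmx T]adjmxK; apply: sep2_conj.
  by apply: (sep2_low_rank (R := S2) IHn r2 _ (ppt2_conj pT)); rewrite adjmxK.
have [big|[en e1 e2]] := rank_dichotomy n3 r1 r2.
  apply: sepM_extremal_step big ES => t1 t2 T1 T2 lt; apply: IHk.
  exact: leq_trans lt _.
have [uA|nuA] := boolP (ulsubmx T \in unitmx).
  rewrite /sepM; clearbody T; case: en => en; subst n s1 s2.
  exact: (@sep2_rank4 _ _ _ S1 S2).
have [v v0 Av] : exists2 v : 'cV[C]_n.+1, v != 0 & ulsubmx T *m v = 0.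
  exact: nonunit_kernel.
exact: sep2_split IHn pT v0 Av.
Qed.

End StormerWoronowicz.

(** * The pairing with a positive map *)

Section Pairing.
Variable C : numClosedFieldType.

Lemma psd_tr n (A : 'M[C]_n) : psd A -> psd A^T.
Proof.
case/psd_factor => R ->; rewrite trmx_mul.
have -> : R^T *m R^H^T = R^H^T^H *m R^H^T.
  by congr (_ *m _); apply/matrixP => i j; rewrite !mxE conjCK.
exact: psd_gram.
Qed.

Lemma psd_mxsub m n (f : 'I_m -> 'I_n) (A : 'M[C]_n) : psd A -> psd (mxsub f f A).
Proof.
case/psd_factor => R ->; have -> : mxsub f f (R^H *m R) = (colsub f R)^H *m colsub f R.
  by apply/matrixP => i j; rewrite !mxE; apply: eq_bigr => k _; rewrite !mxE.
exact: psd_gram.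
Qed.

Lemma psd_block_dl n (A B B' D : 'M[C]_n) : psd (block_mx A B B' D) -> B' = B^H.
Proof. by case=> + _; rewrite adjmx_block => /eq_block_mx[]. Qed.

Lemma psd_pairing n (A B : 'M[C]_n) : psd A -> psd B -> 0 <= \sum_p \sum_q A p q * B p q.
Proof.
case/psd_factor => R -> [_ pB].
have -> : \sum_p \sum_q (R^H *m R) p q * B p q =
    \sum_s ((row s R)^T^H *m B *m (row s R)^T) 0 0.
  under eq_bigr => p _ do under eq_bigr => q _ do rewrite mxE big_distrl /=.
  under eq_bigr => p _ do rewrite exchange_big /=.
  rewrite exchange_big /=; apply: eq_bigr => s _.
  rewrite mxE exchange_big; apply: eq_bigr => q _; rewrite [in RHS]mxE big_distrl /=.
  by apply: eq_bigr => p _; rewrite !mxE; ring.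
by apply: sumr_ge0 => s _; apply: pB.
Qed.

Lemma gram_mx_eq0 m n (X : 'M[C]_(m, n)) : X^H *m X = 0 -> X = 0.
Proof.
move=> X0; apply/matrixP => i j; rewrite mxE.
have := @gram_col_eq0 C m (col j X).
have -> : ((col j X)^H *m col j X) 0 0 = (X^H *m X) j j.
  by rewrite !mxE; apply: eq_bigr => k _; rewrite !mxE.
by rewrite X0 mxE => /(_ erefl)/colP/(_ i); rewrite !mxE.
Qed.

(** From a factor [V W], A = V^H V and B = V^H W, so the kernel of A is killed by B^H. The matrix K
    replaces A^-1 B in the Schur complement when A is singular. *)
Lemma psd_block_range n (A B D : 'M[C]_n) : psd (block_mx A B B^H D) -> exists K, B = A *m K.
Proof.
move=> p; have hA : A^H = A by case: p => + _; rewrite adjmx_block => /eq_block_mx[].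
have [S] := psd_factor p; rewrite -[S]hsubmxK adjmx_row mul_col_row.
move: (lsubmx S) (rsubmx S) => V W /eq_block_mx[EA EB _ _].
have : (B^H <= A)%MS.
  rewrite submxE EB adjmxM adjmxK -mulmxA (@gram_mx_eq0 _ _ (V *m cokermx A)) ?mulmx0 //.
  by rewrite adjmxM -mulmxA (mulmxA V^H) -EA mulmx_coker mulmx0.
case/submxP => K BK; exists K^H.
by rewrite -[B]adjmxK BK adjmxM hA.
Qed.

Lemma psd_schur n (A K D : 'M[C]_n) :
  psd (block_mx A (A *m K) (A *m K)^H D) -> psd (D - K^H *m A *m K).
Proof.
move=> p; have hA : A^H = A by case: p => + _; rewrite adjmx_block => /eq_block_mx[].
have := psd_congr (col_mx (- K) 1%:M) p.
rewrite adjmx_col adjmxN adjmx1 mul_row_block mul_row_col !mul1mx !mulmx1 adjmxM hA.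
rewrite mulNmx addNr mul0mx add0r mulNmx addrC mulmxA.
by congr psd.
Qed.

(** A product matrix zz^H (x) vv^H is sent to zz^H (x) P(vv^H), so positivity of P on rank-one
    matrices suffices. *)
Lemma sep2_positive_image n p (P : {linear 'M[C]_n -> 'M[C]_p}) (A B D : 'M[C]_n) :
  (forall y : 'cV[C]_n, psd (P (y *m y^H))) -> sep2 A B D ->
  psd (block_mx (P A) (P B) (P B)^H (P D)).
Proof.
move=> pP; elim=> [|z0 z1 v|A1 B1 D1 A2 B2 D2 _ s1 _ s2].
- by rewrite linear0 adjmx0 block_mx0; apply: psd0.
- rewrite !linearZ_LR /=; have [R ->] := psd_factor (pP v).
  have -> : block_mx ((z0 * z0^*) *: (R^H *m R)) ((z0 * z1^*) *: (R^H *m R))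
      ((z0 * z1^*) *: (R^H *m R))^H ((z1 * z1^*) *: (R^H *m R)) =
      (row_mx (z0^* *: R) (z1^* *: R))^H *m row_mx (z0^* *: R) (z1^* *: R).
    have e z w : (z^* *: R)^H *m (w^* *: R) = (z * w^*) *: (R^H *m R).
      by rewrite adjmxZ conjCK -scalemxAl -scalemxAr scalerA.
    by rewrite gram_row_block !e.
  exact: psd_gram.
- by rewrite !linearD adjmxD -add_block_mx; apply: psdD.
Qed.

Lemma psd_rank1 n (u : 'cV[C]_n) : psd (u *m u^H).
Proof. by have := psd_gram u^H; rewrite adjmxK. Qed.

(** The Choi matrix given entrywise, which is easier to compute with than a sum of tensor products;
    [choiE] identifies the two. *)
Definition choi_entries n (phi : 'M[C]_n -> 'M[C]_n) : 'M[C]_(n * n) :=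
  \matrix_(p, q) phi (delta_mx (mxtens_unindex p).1 (mxtens_unindex q).1)
                   (mxtens_unindex p).2 (mxtens_unindex q).2.

(** The ampliation is applied to uu^H for the unnormalised maximally entangled vector u. *)
Lemma cp_choi_entries n (phi : 'M[C]_n -> 'M[C]_n) :
  completely_positive phi -> psd (choi_entries phi).
Proof.
pose u : 'cV[C]_(n * n) := \col_p ((mxtens_unindex p).1 == (mxtens_unindex p).2)%:R.
move=> /(_ n _ (psd_rank1 u)); congr psd.
apply/matrixP => p q; rewrite !mxE; congr (phi _ _ _).
apply/matrixP => i j; rewrite !mxE big_ord1 !mxE !mxtens_indexK /= conjC_nat.
by rewrite -natrM mulnb ![_ == i]eq_sym ![_ == j]eq_sym.
Qed.

Lemma cp_outer_block n (phi : 'M[C]_n -> 'M[C]_n) (x0 x1 : 'cV[C]_n) :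
  completely_positive phi ->
  psd (block_mx (phi (x0 *m x0^H)) (phi (x0 *m x1^H)) (phi (x1 *m x0^H)) (phi (x1 *m x1^H))).
Proof.
pose x (a : 'I_2) := if a == 0 then x0 else x1.
pose u : 'cV[C]_(2 * n) := \col_p x (mxtens_unindex p).1 (mxtens_unindex p).2 0.
pose f (p : 'I_(n + n)) : 'I_(2 * n) := match fintype.split p with
  inl i => mxtens_index (0, i) | inr i => mxtens_index (1, i) end.
have fl i : f (lshift n i) = mxtens_index (0, i) by rewrite /f (unsplitK (inl i)).
have fr i : f (rshift n i) = mxtens_index (1, i) by rewrite /f (unsplitK (inr i)).
move=> /(_ 2 _ (psd_rank1 u)) /(psd_mxsub f); congr psd.
have E a b i j : ampl phi (u *m u^H) (mxtens_index (a, i)) (mxtens_index (b, j)) =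
    phi (x a *m (x b)^H) i j.
  rewrite mxE !mxtens_indexK /=; congr (phi _ _ _).
  by apply/matrixP => k l; rewrite !mxE !big_ord1 !mxE !mxtens_indexK.
apply/matrixP => p q; rewrite mxE.
have [i ->|i ->] := split_ordP p; have [j ->|j ->] := split_ordP q;
by rewrite ?fl ?fr ?block_mxEul ?block_mxEur ?block_mxEdl ?block_mxEdr E.
Qed.

Lemma ppt_outer_block n (phi : 'M[C]_n -> 'M[C]_n) (x0 x1 : 'cV[C]_n) : PPT phi ->
  ppt2 (phi (x0 *m x0^H)) (phi (x0 *m x1^H)) (phi (x1 *m x1^H)) /\
  phi (x1 *m x0^H) = (phi (x0 *m x1^H))^H.
Proof.
case=> /(cp_outer_block x0 x1) p /(cp_outer_block x0 x1) /psd_tr.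
have dl := psd_block_dl p; rewrite dl in p *.
by rewrite tr_block_mx !trmxK => q; split.
Qed.

(** [Y k l] collects the output entries (k, l) over all matrix units: these are the blocks of the
    Choi matrix compressed to two output indices, with the output as qubit factor. *)
Lemma ppt_choi_slices n (phi : 'M[C]_n -> 'M[C]_n) (k l : 'I_n) :
  let Y k l := \matrix_(i, j) phi (delta_mx i j) k l in
  PPT phi -> ppt2 (Y k k) (Y k l) (Y l l) /\ Y l k = (Y k l)^H.
Proof.
move=> Y [/cp_choi_entries p /cp_choi_entries q].
pose f (s : 'I_(n + n)) : 'I_(n * n) := match fintype.split s with
  inl i => mxtens_index (i, k) | inr i => mxtens_index (i, l) end.
have fl i : f (lshift n i) = mxtens_index (i, k) by rewrite /f (unsplitK (inl i)).
have fr i : f (rshift n i) = mxtens_index (i, l) by rewrite /f (unsplitK (inr i)).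
have {}p : psd (block_mx (Y k k) (Y k l) (Y l k) (Y l l)).
  move: (psd_mxsub f p); congr psd; apply/matrixP => s t; rewrite mxE.
  have [i ->|i ->] := split_ordP s; have [j ->|j ->] := split_ordP t;
  by rewrite ?fl ?fr ?block_mxEul ?block_mxEur ?block_mxEdl ?block_mxEdr !mxE !mxtens_indexK.
have {}q : psd (block_mx (Y k k) (Y l k) (Y k l) (Y l l)).
  move: (psd_mxsub f q); congr psd; apply/matrixP => s t; rewrite mxE.
  have [i ->|i ->] := split_ordP s; have [j ->|j ->] := split_ordP t;
  by rewrite ?fl ?fr ?block_mxEul ?block_mxEur ?block_mxEdl ?block_mxEdr !mxE !mxtens_indexK.
have dl := psd_block_dl p; split=> //.
by rewrite dl in p q; split.
Qed.

Lemma sum_mxtens n (F : 'I_(n * n) -> C) :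
  \sum_p F p = \sum_i \sum_k F (mxtens_index (i, k)).
Proof.
rewrite pair_bigA /= (reindex (@mxtens_index n n)) /=.
  by apply: eq_bigr => -[].
by exists (@mxtens_unindex n n) => p _; rewrite ?mxtens_indexK ?mxtens_unindexK.
Qed.

(** On the product of (z0, z1) and v, the pairing is the quadratic form of the matrix in the
    hypothesis at the conjugate of v. *)
Lemma sep2_pairing_ge0 n (G11 G12 G21 G22 : 'M[C]_n) (A B D : 'M[C]_n) :
  (forall z0 z1 : C, psd ((z0 * z0^*) *: G11 + (z0 * z1^*) *: G12
    + (z1 * z0^*) *: G21 + (z1 * z1^*) *: G22)) ->
  sep2 A B D -> 0 <= \sum_i \sum_j
    (A i j * G11 i j + B i j * G12 i j + B^H i j * G21 i j + D i j * G22 i j).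
Proof.
move=> hG; elim=> [|z0 z1 v|A1 B1 D1 A2 B2 D2 _ s1 _ s2].
- by rewrite big1 // => i _; rewrite big1 // => j _; rewrite !mxE conjC0 !mul0r !addr0.
- have [_ /(_ (map_mx Num.conj v))] := hG z0 z1; congr (0 <= _).
  rewrite mxE exchange_big; apply: eq_bigr => j _; rewrite [in LHS]mxE big_distrl /=.
  apply: eq_bigr => i _; rewrite !mxE !big_ord1 !mxE !conjCK !rmorphM /= !conjCK; ring.
- have := addr_ge0 s1 s2; congr (0 <= _); rewrite -big_split; apply: eq_bigr => i _ /=.
  rewrite -big_split; apply: eq_bigr => j _ /=.
  by rewrite adjmxD !mxE; ring.
Qed.

(* L i j, K and Q are the blocks of P o phi, its Schur factors and the Schur
   complement at the block (0, 0). *)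
Lemma ppt_square_pairing (phi P : {linear 'M[C]_3 -> 'M[C]_3}) : PPT phi ->
  (forall y : 'cV[C]_3, psd (P (y *m y^H))) -> (forall Y, P Y^H = (P Y)^H) ->
  0 <= \sum_i \sum_j P (phi (phi (delta_mx i j))) i j.
Proof.
move=> pphi pP hP; pose L i j := P (phi (delta_mx i j)).
have Lsum Y : P (phi Y) = \sum_k \sum_l Y k l *: L k l.
  rewrite {1}[Y]matrix_sum_delta !linear_sum; apply: eq_bigr => k _.
  by rewrite !linear_sum; apply: eq_bigr => l _; rewrite !linearZ_LR.
have Lout (x y : 'cV_3) : P (phi (x *m y^H)) = \sum_i \sum_j (x i 0 * (y j 0)^*) *: L i j.
  by rewrite Lsum; apply: eq_bigr => i _; apply: eq_bigr => j _; rewrite !mxE big_ord1 !mxE.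
have L2 (x0 x1 : 'cV_3) : psd (block_mx (P (phi (x0 *m x0^H))) (P (phi (x0 *m x1^H)))
    (P (phi (x0 *m x1^H)))^H (P (phi (x1 *m x1^H)))).
  apply: sep2_positive_image => //; apply: stormer_woronowicz => //.
  by case: (ppt_outer_block x0 x1 pphi).
pose e i : 'cV[C]_3 := delta_mx i 0.
have dE i j : delta_mx i j = e i *m (e j)^H.
  by apply/matrixP => s t; rewrite !mxE big_ord1 !mxE !andbT conjC_nat -natrM mulnb.
have Lh i j : L j i = (L i j)^H.
  by rewrite /L !dE; have [_ ->] := ppt_outer_block (e i) (e j) pphi; rewrite hP.
pose A := L 0 0; have hA : A^H = A by rewrite /A -Lh.
have L0x x : P (phi (e 0 *m x^H)) = \sum_j (x j 0)^* *: L 0 j.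
  rewrite Lout (bigD1 0) //= [X in _ + X]big1 ?addr0 => [|i /negPf i0].
    by apply: eq_bigr => j _; rewrite mxE !eqxx mul1r.
  by rewrite big1 // => j _; rewrite mxE i0 mul0r scale0r.
have [K KE] : exists K : 'I_3 -> 'M[C]_3, forall j, L 0 j = A *m K j /\ (j = 0 -> K j = 1%:M).
  apply: (@fin_all_exists _ _ (fun j M => L 0 j = A *m M /\ (j = 0 -> M = 1%:M))) => j.
  have [->|j0] := eqVneq j 0; first by exists 1%:M; rewrite mulmx1.
  have [|M EM] := @psd_block_range 3 A (L 0 j) (L j j).
    by have := L2 (e 0) (e j); rewrite -!dE.
  by exists M; split=> // /eqP; rewrite (negPf j0).
have L0 j : L 0 j = A *m K j by case: (KE j).
have K0 : K 0 = 1%:M by case: (KE 0) => _; apply.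
pose Q i j := L i j - (K i)^H *m A *m K j.
have Q0l j : Q 0 j = 0 by rewrite /Q K0 adjmx1 mul1mx L0 subrr.
have Q0r i : Q i 0 = 0 by rewrite /Q K0 mulmx1 (Lh 0 i) L0 adjmxM hA subrr.
(* This sum is the Schur complement for the pair of inputs e_0 and x, so 2-positivity of P o phi
   enters here. *)
have psdQ (x : 'cV[C]_3) : psd (\sum_i \sum_j (x i 0 * (x j 0)^*) *: Q i j).
  pose Kx := \sum_j (x j 0)^* *: K j.
  have EK : P (phi (e 0 *m x^H)) = A *m Kx.
    rewrite L0x mulmx_sumr; apply: eq_bigr => j _.
    by rewrite L0 scalemxAr.
  have := L2 (e 0) x; rewrite EK -dE => /psd_schur; congr psd.
  rewrite Lout adjmx_sum !mulmx_suml -sumrB; apply: eq_bigr => i _.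
  rewrite mulmx_sumr -sumrB; apply: eq_bigr => j _.
  by rewrite adjmxZ conjCK -!scalemxAl -scalemxAr scalerA -scalerBr.
have split_sum i j : P (phi (phi (delta_mx i j))) i j =
    \sum_k \sum_l phi (delta_mx i j) k l * Q k l i j +
    \sum_k \sum_l phi (delta_mx i j) k l * ((K k)^H *m A *m K l) i j.
  rewrite Lsum summxE -big_split; apply: eq_bigr => k _ /=.
  rewrite summxE -big_split; apply: eq_bigr => l _ /=.
  by rewrite mxE -mulrDr /Q mxE [(- _ : 'M_(_, _)) _ _]mxE subrK.
under eq_bigr => i _ do under eq_bigr => j _ do rewrite split_sum.
under eq_bigr => i _ do rewrite big_split /=.
rewrite big_split /=; apply: addr_ge0.
(* Row and column 0 of [Q] vanish, so only the compression of phi to the output indices a, b is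
   paired. *)
- have [a [b [sE _ ab]]] := ord3_split 0.
  pose Y k l := \matrix_(i, j) phi (delta_mx i j) k l.
  have [pY Yh] := ppt_choi_slices a b pphi.
  have := @sep2_pairing_ge0 3 (Q a a) (Q a b) (Q b a) (Q b b) (Y a a) (Y a b) (Y b b).
  rewrite -Yh => h; have {h} := h _ (stormer_woronowicz _ pY).
  have -> : \sum_i \sum_j (Y a a i j * Q a a i j + Y a b i j * Q a b i j +
      Y b a i j * Q b a i j + Y b b i j * Q b b i j) =
    \sum_i \sum_j \sum_k \sum_l phi (delta_mx i j) k l * Q k l i j.
    apply: eq_bigr => i _; apply: eq_bigr => j _.
    by rewrite !sE !Q0l !Q0r !mxE !mulr0 !addr0 addrA.
  apply=> // z0 z1; have := psdQ (z0 *: e a + z1 *: e b); congr psd.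
  have xa : (z0 *: e a + z1 *: e b) a 0 = z0 by rewrite !mxE !eqxx ab mulr1 mulr0 addr0.
  have xb : (z0 *: e a + z1 *: e b) b 0 = z1.
    by rewrite !mxE !eqxx eq_sym ab mulr1 mulr0 add0r.
  by rewrite !sE xa xb !Q0l !Q0r !scaler0 !addr0 !addrA.
(* The completely positive part pairs the Choi matrix of phi with the Gram matrix of the columns of
   all [S *m K k], where A = S^H S. *)
pose G : 'M[C]_(3 * 3) := \matrix_(p, q)
  ((K (mxtens_unindex p).2)^H *m A *m K (mxtens_unindex q).2)
    (mxtens_unindex p).1 (mxtens_unindex q).1.
have pG : psd G.
  have [S ES] : exists S : 'M[C]_3, A = S^H *m S.
    by apply: psd_factor; have := L2 (e 0) (e 0); rewrite -dE => /psd_block_ul.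
  have -> : G = (\matrix_(s, p) (S *m K (mxtens_unindex p).2) s (mxtens_unindex p).1)^H *m
                (\matrix_(s, p) (S *m K (mxtens_unindex p).2) s (mxtens_unindex p).1).
    apply/matrixP => p q; rewrite mxE ES mulmxA -adjmxM -mulmxA !mxE.
    by apply: eq_bigr => s _; rewrite !mxE.
  exact: psd_gram.
have [pC _] := pphi; have := psd_pairing (cp_choi_entries pC) pG; congr (0 <= _).
rewrite sum_mxtens; apply: eq_bigr => i _.
rewrite [RHS]exchange_big; apply: eq_bigr => k _; rewrite sum_mxtens.
apply: eq_bigr => j _; apply: eq_bigr => l _.
by rewrite !mxE !mxtens_indexK.
Qed.

End Pairing.

Local Open Scope classical_set_scope.
Local Open Scope ring_scope.

(** * The bipolar theorem for the cone over a compact set *)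

Section Dot.
Variables (R : realType) (n : nat).
Implicit Types (u v w : 'rV[R]_n).

Definition dot u v : R := \sum_i u 0 i * v 0 i.

Lemma dotC u v : dot u v = dot v u.
Proof. by apply: eq_bigr => i _; rewrite mulrC. Qed.

Lemma dotDl u v w : dot (u + v) w = dot u w + dot v w.
Proof. by rewrite -big_split; apply: eq_bigr => i _; rewrite mxE mulrDl. Qed.

Lemma dotZl c u v : dot (c *: u) v = c * dot u v.
Proof. by rewrite mulr_sumr; apply: eq_bigr => i _; rewrite mxE mulrA. Qed.

Lemma dotNl u v : dot (- u) v = - dot u v.
Proof. by rewrite -scaleN1r dotZl mulN1r. Qed.

Lemma dotDr u v w : dot u (v + w) = dot u v + dot u w.
Proof. by rewrite ![dot u _]dotC dotDl. Qed.

Lemma dotZr c u v : dot u (c *: v) = c * dot u v.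
Proof. by rewrite ![dot u _]dotC dotZl. Qed.

Lemma dotNr u v : dot u (- v) = - dot u v.
Proof. by rewrite ![dot u _]dotC dotNl. Qed.

Lemma dot0r u : dot u 0 = 0.
Proof. by rewrite -(scale0r 0) dotZr mul0r. Qed.

Lemma dot_ge0 u : 0 <= dot u u.
Proof. by apply: sumr_ge0 => i _; rewrite -expr2 sqr_ge0. Qed.

Lemma dot_eq0 u : dot u u <= 0 -> u = 0.
Proof.
move=> u0; have /eqP : dot u u = 0 by apply/eqP; rewrite eq_le u0 dot_ge0.
rewrite psumr_eq0 => [/allP h|i _]; last by rewrite -expr2 sqr_ge0.
apply/rowP => i; rewrite mxE; apply/eqP.
by have := h i (mem_index_enum i); rewrite mulf_eq0 orbb.
Qed.

Lemma dot_sumr I (r : seq I) u (F : I -> 'rV[R]_n) :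
  dot u (\sum_(i <- r) F i) = \sum_(i <- r) dot u (F i).
Proof. by elim/big_rec2: _ => [|i x y _ <-]; rewrite ?dot0r ?dotDr. Qed.

End Dot.

(** Replaces the limit e -> 0: if a < 0, the value e = - a / (- a + |b|) already makes a + e b
    negative. *)
Lemma ge0_of_linear_perturbation (R : realType) (a b : R) :
  (forall e, 0 < e -> e <= 1 -> 0 <= a + e * b) -> 0 <= a.
Proof.
move=> h; rewrite leNgt; apply/negP => a0.
have d0 : 0 < - a + `|b| by rewrite ltr_pwDl ?oppr_gt0 // normr_ge0.
have e0 : 0 < - a / (- a + `|b|) by rewrite divr_gt0 ?oppr_gt0.
have e1 : - a / (- a + `|b|) <= 1 by rewrite ler_pdivrMr // mul1r lerDl.
have := h _ e0 e1; apply/negP; rewrite -ltNge.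
apply: le_lt_trans (_ : a + - a / (- a + `|b|) * `|b| < 0).
  by rewrite lerD2l ler_wpM2l ?ler_norm // ltW.
have -> : a + - a / (- a + `|b|) * `|b| = - (a * a) / (- a + `|b|).
  by field; rewrite gt_eqF.
by rewrite pmulr_llt0 ?invr_gt0 // oppr_lt0 -expr2 exprn_even_gt0 //= lt_eqF.
Qed.

Section Cone.
Variables (R : realType) (n : nat) (S : set 'rV[R]_n).

Definition cone k (v : 'rV[R]_n) := exists (c : 'I_k -> R) (s : 'I_k -> 'rV[R]_n),
  [/\ forall t, 0 <= c t, forall t, S (s t) & v = \sum_t c t *: s t].

(** More than n vectors are dependent; the coefficients are moved along a dependence u until the
    first of them vanishes, at the index minimising c / u over positive u. *)
Lemma caratheodory_step k v : (n <= k)%N -> cone k.+1 v -> cone k v.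
Proof.
move=> nk [c [s [c0 Ss ->]]].
have [u u0 us] : exists2 u : 'rV[R]_k.+1, u != 0 & \sum_t u 0 t *: s t = 0.
  have : kermx (\matrix_t s t) != 0.
    rewrite -mxrank_eq0 mxrank_ker -lt0n subn_gt0.
    by apply: leq_ltn_trans (rank_leq_col _) _.
  move=> /rowV0Pn[u /sub_kermxP uM u0]; exists u => //.
  rewrite -[RHS]uM; apply/rowP => i; rewrite [LHS]summxE [RHS]mxE; apply: eq_bigr => t _.
  by rewrite !mxE.
wlog [t ut] : u u0 us / exists t, 0 < u 0 t.
  move=> h; have [[t ut]|nt] := pselect (exists t, 0 < u 0 t).
    by apply: (h u) => //; exists t.
  apply: (h (- u)); rewrite ?oppr_eq0 //.
    transitivity (- \sum_t u 0 t *: s t); last by rewrite us oppr0.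
    by rewrite -sumrN; apply: eq_bigr => t _; rewrite mxE scaleNr.
  apply: contrapT => nt'; move/eqP: u0; apply; apply/rowP => t; rewrite mxE.
  apply/eqP; rewrite eq_le; apply/andP; split; rewrite leNgt; apply/negP => ut.
    by apply: nt; exists t.
  by apply: nt'; exists t; rewrite mxE oppr_gt0.
have [t0 ut0 tmin] := @Order.TotalTheory.arg_minP _ _ _ t
  (fun t => 0 < u 0 t) (fun t => c t / u 0 t) ut.
pose r := c t0 / u 0 t0; pose c' t := c t - r * u 0 t.
have c't0 : c' t0 = 0 by rewrite /c' /r divfK ?subrr // gt_eqF.
have r0 : 0 <= r by rewrite divr_ge0 // ltW.
have c'0 t1 : 0 <= c' t1.
  rewrite subr_ge0; have [u1|u1] := ltP 0 (u 0 t1).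
    by rewrite -ler_pdivlMr //; apply: tmin.
  by apply: le_trans (c0 t1); rewrite mulr_ge0_le0.
exists (fun t => c' (lift t0 t)), (fun t => s (lift t0 t)); split=> //.
transitivity (\sum_t c' t *: s t); last by rewrite (bigD1_ord t0) //= c't0 scale0r add0r.
have -> : \sum_t c' t *: s t = \sum_t c t *: s t - r *: \sum_t u 0 t *: s t.
  by rewrite scaler_sumr -sumrB; apply: eq_bigr => t1 _; rewrite scalerBl scalerA.
by rewrite us scaler0 subr0.
Qed.

(* Bounding the coefficients by M makes the cone compact. *)
Fixpoint tcone (M : R) k : set 'rV[R]_n :=
  if k is k'.+1 then
    (fun p : 'rV[R]_n * (R * 'rV[R]_n) => p.1 + p.2.1 *: p.2.2) @`
      (tcone M k' `*` ([set` `[0, M]%R] `*` S))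
  else [set 0].

Lemma tcone_compact M k : compact S -> compact (tcone M k).
Proof.
move=> cS; elim: k => [|k IHk] /=; first exact: compact_set1.
apply: continuous_compact; last first.
  by apply: compact_setX => //; apply: compact_setX => //; apply: segment_compact.
apply: continuous_subspaceT => p; apply: cvgD; first exact: cvg_fst.
apply: cvgZ; [apply: (cvg_comp _ _ cvg_snd); exact: cvg_fst|].
by apply: (cvg_comp _ _ cvg_snd); exact: cvg_snd.
Qed.

Lemma tcone_cone M k v : tcone M k v -> cone k v.
Proof.
elim: k v => [|k IHk] v /=.
  move=> ->; exists (fun=> 0), (fun=> 0); split=> [//|[]//|]; by rewrite big_ord0.
move=> [[a [c s]] /= [/IHk[c' [s' [c'0 Ss' ->]]] [/andP[c0 _] Ss] <-]].
exists (fun t => if unlift ord_max t is Some t' then c' t' else c).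
exists (fun t => if unlift ord_max t is Some t' then s' t' else s).
split=> [t|t|]; [by case: unliftP|by case: unliftP|].
rewrite (bigD1_ord ord_max) //= unlift_none addrC; congr (_ + _).
by apply: eq_bigr => t _; rewrite liftK.
Qed.

Lemma cone_tcone M k (c : 'I_k -> R) (s : 'I_k -> 'rV[R]_n) :
  (forall t, 0 <= c t <= M) -> (forall t, S (s t)) -> tcone M k (\sum_t c t *: s t).
Proof.
elim: k c s => [|k IHk] c s cM Ss; first by rewrite big_ord0.
rewrite big_ord_recr /=.
exists (\sum_t c (widen_ord (leqnSn k) t) *: s (widen_ord (leqnSn k) t),
  (c ord_max, s ord_max)) => //=.
split; first by apply: IHk => t.
by split=> //; rewrite /= in_itv /=; apply: cM.
Qed.

Lemma continuous_dot_sub (v : 'rV[R]_n) : continuous (fun a : 'rV[R]_n => dot (a - v) (a - v)).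
Proof.
have -> : (fun a : 'rV[R]_n => dot (a - v) (a - v)) =
    (fun a => \big[+%R/0]_(i <- index_enum 'I_n | xpredT i) ((a - v) 0 i * (a - v) 0 i)).
  by [].
apply: (continuous_big (P := xpredT)) => [|i _ a].
  by move=> z; apply: (@cvgD R R^o); [exact: cvg_fst|exact: cvg_snd].
have -> : (fun x : 'rV[R]_n => (x - v) 0 i * (x - v) 0 i) =
    (fun r : R => (r - v 0 i) * (r - v 0 i)) \o (fun x : 'rV[R]_n => x 0 i).
  by apply/funext => x; rewrite /= !mxE.
apply: continuous_comp; first exact: coord_continuous.
by apply: cvgM; apply: cvgB; [exact: cvg_id|exact: cvg_cst|exact: cvg_id|exact: cvg_cst].
Qed.

(** Let s0 be the point of the truncated cone nearest to v, and w = s0 - v. Moving s0 towards points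
    of S and towards 0 shows w >= 0 on S and dot w s0 <= 0; with dot w v >= 0 this gives dot w w <=
    0. *)
Theorem cone_bipolar (l : 'rV[R]_n) (v : 'rV[R]_n) : S !=set0 -> compact S ->
  (forall s, S s -> dot l s = 1) ->
  (forall w, (forall s, S s -> 0 <= dot w s) -> 0 <= dot w v) -> cone n v.
Proof.
(* Comparison with the point 0 gives |s0 - v| <= |v|, so dot l (s0 - v) <= (|l|^2 + |v|^2) / 2; the
   extra 1 leaves room for the perturbations. *)
move=> [s1 Ss1] cS lS hv; pose M := dot l v + (dot l l + dot v v) / 2 + 1.
pose f (a : 'rV[R]_n) := dot (a - v) (a - v).
have M0 : 0 <= M.
  have := dot_ge0 (l + v); rewrite dotDl !dotDr (dotC v l) /M; lra.
have T0 k : tcone M k 0.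
  have := @cone_tcone M k (fun=> 0) (fun=> s1) (fun=> _) (fun=> Ss1).
  by rewrite big1 => [|i _]; [apply; rewrite lexx|rewrite scale0r].
have [||s0 s0T fmin] := @compact_EVT_min _ _ f (tcone M n) _ (tcone_compact cS).
- by exists 0.
- exact/continuous_subspaceT/continuous_dot_sub.
rewrite inE in s0T.
have {}fmin a : tcone M n a -> f s0 <= f a by move=> Ta; apply: fmin; rewrite inE.
have ls0 : dot l s0 + 1 <= M.
  have := fmin _ (T0 n); have := dot_ge0 (l - (s0 - v)); rewrite /f sub0r.
  rewrite !(dotDl, dotDr, dotNl, dotNr) !opprK (dotC v s0) (dotC v l) (dotC s0 l) /M.
  lra.
(* Caratheodory reduces to n points, and since l is 1 on S each coefficient is at most dot l a <=
   M. *)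
have fit k a : (n <= k)%N -> cone k a -> dot l a <= M -> tcone M n a.
  move=> nk ca la; have {ca} [c [s [c0 Ss Ea]]] : cone n a.
    elim: k nk ca => [|k IHk]; first by rewrite leqn0 => /eqP ->.
    by rewrite leq_eqVlt => /orP[/eqP -> //|nk] /(caratheodory_step nk); apply: IHk.
  rewrite Ea; apply: cone_tcone => // t; rewrite c0 /=.
  apply: le_trans la; rewrite Ea dot_sumr (bigD1 t) //= dotZr lS // mulr1 lerDl.
  by apply: sumr_ge0 => i _; rewrite dotZr lS // mulr1.
have ls0_ge0 : 0 <= dot l s0.
  have [c [s [c0 Ss ->]]] := tcone_cone s0T; rewrite dot_sumr.
  by apply: sumr_ge0 => i _; rewrite dotZr lS // mulr1.
have perturb b : (forall e, 0 < e -> e <= 1 -> tcone M n (s0 + e *: b)) -> 0 <= dot (s0 - v) b.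
  move=> Tb; suff : 0 <= 2 * dot (s0 - v) b by rewrite pmulr_rge0.
  apply: (@ge0_of_linear_perturbation _ _ (dot b b)) => e e0 e1.
  rewrite -(pmulr_rge0 _ e0); have := fmin _ (Tb e e0 e1).
  rewrite /f addrAC; move: (s0 - v) => w.
  rewrite !(dotDl, dotDr, dotZl, dotZr) (dotC b w); lra.
have w_s s : S s -> 0 <= dot (s0 - v) s.
  move=> Ss; apply: perturb => e e0 e1; apply: (fit n.+1) => //; last first.
    by rewrite dotDr dotZr (lS s) // mulr1 (le_trans _ ls0) // lerD2l.
  have [c [s' [c0 Ss' ->]]] := tcone_cone s0T.
  exists (fun t => if unlift ord_max t is Some t' then c t' else e).
  exists (fun t => if unlift ord_max t is Some t' then s' t' else s).
  split=> [t|t|]; [by case: unliftP => // *; apply: ltW|by case: unliftP|].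
  rewrite (bigD1_ord ord_max) //= unlift_none addrC; congr (_ + _).
  by apply: eq_bigr => t _; rewrite liftK.
have w_s0 : 0 <= dot (s0 - v) (- s0).
  apply: perturb => e e0 e1; apply: (fit n) => //; last first.
    rewrite dotDr dotZr dotNr mulrN (le_trans _ ls0) // lerD2l.
    by rewrite (le_trans _ ler01) // oppr_le0 mulr_ge0 // ltW.
  have [c [s' [c0 Ss' ->]]] := tcone_cone s0T.
  exists (fun t => (1 - e) * c t), s'; split=> // [t|].
    by rewrite mulr_ge0 // subr_ge0.
  rewrite -sumrN scaler_sumr -big_split; apply: eq_bigr => t _ /=.
  by rewrite mulrBl mul1r scalerBl scalerN scalerA.
have /dot_eq0/eqP : dot (s0 - v) (s0 - v) <= 0.
  have := hv _ w_s; move: w_s0; rewrite dotNr dotDr dotNr; lra.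
by rewrite subr_eq0 => /eqP <-; apply: tcone_cone s0T.
Qed.

End Cone.

(** * Duality for separable matrices *)

Section Contract.
Variable C : numClosedFieldType.
Variable n : nat.

(** The map attached to W, with the convention that pairing W with the Choi matrix of psi gives the
    sum of the entries (i, j) of [contract W (psi (delta_mx i j))]. *)
Definition contract (W : 'M[C]_(n * n)) (Y : 'M[C]_n) : 'M[C]_n :=
  \matrix_(i, j) \sum_k \sum_l W (mxtens_index (i, k)) (mxtens_index (j, l)) * Y k l.

Lemma contract_is_linear W : linear (contract W).
Proof.
move=> a X Y; apply/matrixP => i j; rewrite !mxE mulr_sumr -big_split.
apply: eq_bigr => k _ /=; rewrite mulr_sumr -big_split.
by apply: eq_bigr => l _ /=; rewrite !mxE; ring.
Qed.

HB.instance Definition _ W :=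
  GRing.isLinear.Build C 'M[C]_n 'M[C]_n _ (contract W) (contract_is_linear W).

Lemma contract_adj W Y : W^H = W -> contract W Y^H = (contract W Y)^H.
Proof.
move=> hW; apply/matrixP => i j; rewrite !mxE raddf_sum exchange_big.
apply: eq_bigr => k _; rewrite raddf_sum; apply: eq_bigr => l _ /=.
by rewrite rmorphM -{1}hW !mxE.
Qed.

Lemma sum_pairing_mxtens (F : 'I_(n * n) -> 'I_(n * n) -> C) :
  \sum_p \sum_q F p q =
  \sum_i \sum_j \sum_k \sum_l F (mxtens_index (i, k)) (mxtens_index (j, l)).
Proof.
rewrite sum_mxtens; apply: eq_bigr => i _; rewrite [RHS]exchange_big.
by apply: eq_bigr => k _; rewrite sum_mxtens.
Qed.

Lemma contract_psd W (y : 'cV[C]_n) : W^H = W ->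
  (forall x y : 'cV[C]_n, 0 <= \sum_p \sum_q W p q * ((x *m x^H) *t (y *m y^H)) p q) ->
  psd (contract W (y *m y^H)).
Proof.
move=> hW pW; split; first by rewrite -contract_adj // adj_rank1.
move=> v; have := pW (map_mx Num.conj v) y; congr (0 <= _).
rewrite sum_pairing_mxtens mxE exchange_big; apply: eq_bigr => j _.
rewrite [in RHS]mxE big_distrl; apply: eq_bigr => i _ /=.
rewrite !mxE big_distrr big_distrl; apply: eq_bigr => k _ /=.
rewrite big_distrr big_distrl; apply: eq_bigr => l _ /=.
by rewrite tensmxE !mxE !big_ord1 !mxE conjCK; ring.
Qed.

Lemma choiE (psi : 'M[C]_n -> 'M[C]_n) : choi psi = choi_entries psi.
Proof.
apply/matrixP => p q; case: (mxtens_indexP p) => i k; case: (mxtens_indexP q) => j l.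
rewrite !mxE !mxtens_indexK summxE (bigD1 i) //= [X in _ + X]big1 => [|i' /negPf i'i]; last first.
  by rewrite summxE big1 // => j' _; rewrite tensmxE mxE eq_sym i'i mul0r.
rewrite addr0 summxE (bigD1 j) //= big1 => [|j' /negPf j'j].
  by rewrite addr0 tensmxE mxE !eqxx mul1r.
by rewrite tensmxE mxE [j == _]eq_sym j'j andbF mul0r.
Qed.

Lemma completely_positive_comp (f g : 'M[C]_n -> 'M[C]_n) :
  completely_positive f -> completely_positive g -> completely_positive (fun X => f (g X)).
Proof.
move=> cf cg k X /cg/cf; congr psd; apply/matrixP => p q; rewrite !mxE.
congr (f _ _ _); apply/matrixP => i j; rewrite !mxE !mxtens_indexK /=.
by [].
Qed.

End Contract.

(** * Complex matrices as real vectors *)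

Section RealCoordinates.
Variables (R : realType) (m : nat).
Local Notation C := R[i].

Definition rvec (H : 'M[C]_m) : 'rV[R]_(m * m + m * m) :=
  row_mx (\row_p complex.Re (mxvec H 0 p)) (\row_p complex.Im (mxvec H 0 p)).

Lemma rvec_inj : injective rvec.
Proof.
move=> G H /eq_row_mx[/rowP hr /rowP hi]; apply: (can_inj mxvecK); apply/rowP => p.
by apply/eqP; rewrite eq_complex; have := hr p; have := hi p; rewrite !mxE => -> ->; rewrite !eqxx.
Qed.

Lemma rvecD G H : rvec (G + H) = rvec G + rvec H.
Proof.
rewrite /rvec add_row_mx; congr row_mx; apply/rowP => p; rewrite !(linearD, mxE) /=.
all: by case: (mxvec G 0 p) (mxvec H 0 p) => [a b] [c d].
Qed.

Lemma rvecZ (c : R) H : rvec (c%:C%C *: H) = c *: rvec H.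
Proof.
rewrite /rvec scale_row_mx; congr row_mx; apply/rowP => p; rewrite !(linearZ_LR, mxE) /=.
all: by case: (mxvec H 0 p) => [a b] /=; rewrite mul0r ?subr0 ?addr0.
Qed.

Lemma rvec_sum I (r : seq I) (F : I -> 'M[C]_m) :
  rvec (\sum_(i <- r) F i) = \sum_(i <- r) rvec (F i).
Proof.
elim/big_rec2: _ => [|i x y _ <-]; last by rewrite rvecD.
by rewrite -(scale0r 0) -[0%R in LHS](rmorph0 (real_complex R)) rvecZ !scale0r.
Qed.

(** The minus sign comes from Re((a - ib)(x + iy)) = ax + by. *)
Lemma dot_rvec (w : 'rV[R]_(m * m + m * m)) H : dot w (rvec H) =
  complex.Re (\sum_p \sum_q Complex (w 0 (lshift _ (mxvec_index p q)))
                                    (- w 0 (rshift _ (mxvec_index p q))) * H p q).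
Proof.
have Re_sum I (r : seq I) (F : I -> C) :
    complex.Re (\sum_(i <- r) F i) = \sum_(i <- r) complex.Re (F i).
  by elim/big_rec2: _ => [|i x y _ <-] //; case: (F i) y => [a b] [c d].
rewrite /dot big_split_ord /= -big_split /= (reindex _ (curry_mxvec_bij _ _)) /= Re_sum.
under [RHS]eq_bigr do rewrite Re_sum.
rewrite pair_bigA; apply: eq_bigr => -[p q] _ /=.
rewrite row_mxEl row_mxEr !mxE mxvecE; case: (H p q) => a b /=; ring.
Qed.

End RealCoordinates.

(** * Compactness of the set of normalised product states *)

Section Compactness.
Variable R : realType.
Local Notation C := R[i].

Lemma continuous_row (T : topologicalType) n (f : T -> 'rV[R]_n) :
  (forall j, continuous (fun t => f t 0 j)) -> continuous f.
Proof.
move=> cf; have -> : f = (fun t => \big[+%R/0]_(j <- index_enum 'I_n | xpredT j)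
    (f t 0 j *: (delta_mx 0 j : 'rV[R]_n))).
  by apply/funext => t; rewrite {1}[f t]row_sum_delta.
apply: (continuous_big (P := xpredT)) => [|j _ t].
  by move=> z; apply: cvgD; [exact: cvg_fst|exact: cvg_snd].
by apply: cvgZr_tmp; apply: cf.
Qed.

Definition complex_continuous (T : topologicalType) (f : T -> C) :=
  continuous (@complex.Re R \o f) /\ continuous (@complex.Im R \o f).

Lemma complex_continuous_mul (T : topologicalType) (f g : T -> C) :
  complex_continuous f -> complex_continuous g -> complex_continuous (fun t => f t * g t).
Proof.
move=> [f1 f2] [g1 g2]; split.
  have -> : @complex.Re R \o (fun t => f t * g t) =
      (fun t => complex.Re (f t) * complex.Re (g t) - complex.Im (f t) * complex.Im (g t)).
    by apply/funext => t /=; case: (f t) (g t) => [a b] [c d].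
  by move=> t; apply: cvgB; apply: cvgM; [apply: f1|apply: g1|apply: f2|apply: g2].
have -> : @complex.Im R \o (fun t => f t * g t) =
    (fun t => complex.Re (f t) * complex.Im (g t) + complex.Im (f t) * complex.Re (g t)).
  by apply/funext => t /=; case: (f t) (g t) => [a b] [c d].
by move=> t; apply: cvgD; apply: cvgM; [apply: f1|apply: g2|apply: f2|apply: g1].
Qed.

Lemma complex_continuous_conj (T : topologicalType) (f : T -> C) :
  complex_continuous f -> complex_continuous (fun t => (f t)^*).
Proof.
move=> [f1 f2]; split.
  have -> // : @complex.Re R \o (fun t => (f t)^*) = @complex.Re R \o f.
  by apply/funext => t /=; case: (f t).
have -> : @complex.Im R \o (fun t => (f t)^*) = (fun t => - complex.Im (f t)).
  by apply/funext => t /=; case: (f t).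
by move=> t; apply: cvgN; apply: f2.
Qed.

Definition cvec n (u : 'rV[R]_(n + n)) : 'cV[C]_n :=
  \col_i Complex (u 0 (lshift n i)) (u 0 (rshift n i)).

Lemma cvec_surj n (x : 'cV[C]_n) : exists u, x = cvec u.
Proof.
exists (row_mx (\row_i complex.Re (x i 0)) (\row_i complex.Im (x i 0))).
by apply/colP => i; rewrite mxE row_mxEl row_mxEr !mxE; case: (x i 0).
Qed.

Lemma cvec_gram n (u : 'rV[R]_(n + n)) : ((cvec u)^H *m cvec u) 0 0 = (dot u u)%:C%C.
Proof.
rewrite /dot big_split_ord /= -big_split /= mxE (rmorph_sum (real_complex R)) /=.
apply: eq_bigr => i _; rewrite !mxE; apply/eqP; rewrite eq_complex /=.
by apply/andP; split; apply/eqP; ring.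
Qed.

Lemma continuous_cvec_coord (T : topologicalType) n (g : T -> 'rV[R]_(n + n)) i :
  continuous g -> complex_continuous (fun t => cvec (g t) i 0).
Proof.
have h j : continuous g -> continuous (fun t => g t 0 j).
  move=> cg t; apply: (@continuous_comp _ _ _ g (fun u : 'rV[R]_(n + n) => u 0 j) t).
    exact: cg.
  exact: coord_continuous.
move=> cg; split.
  have -> : @complex.Re R \o (fun t => cvec (g t) i 0) = (fun t => g t 0 (lshift n i)).
    by apply/funext => t; rewrite /= mxE.
  exact: h.
have -> : @complex.Im R \o (fun t => cvec (g t) i 0) = (fun t => g t 0 (rshift n i)).
  by apply/funext => t; rewrite /= mxE.
exact: h.
Qed.

Definition product_state n (x y : 'cV[C]_n) : 'M[C]_(n * n) := (x *m x^H) *t (y *m y^H).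

Lemma continuous_product_state n :
  continuous (fun p : 'rV[R]_(n + n) * 'rV[R]_(n + n) =>
    rvec (product_state (cvec p.1) (cvec p.2))).
Proof.
apply: continuous_row => q.
have entry p1 p2 : complex_continuous (fun p : 'rV[R]_(n + n) * 'rV[R]_(n + n) =>
    product_state (cvec p.1) (cvec p.2) p1 p2).
  case: (mxtens_indexP p1) => i k; case: (mxtens_indexP p2) => j l.
  have -> : (fun p : 'rV[R]_(n + n) * 'rV[R]_(n + n) =>
     product_state (cvec p.1) (cvec p.2) (mxtens_index (i, k)) (mxtens_index (j, l))) =
    (fun p => (cvec p.1 i 0 * (cvec p.1 j 0)^*) * (cvec p.2 k 0 * (cvec p.2 l 0)^*)).
    by apply/funext => p; rewrite tensmxE ![(_ *m _) _ _]mxE !big_ord1 ![_^H _ _]adjmxE.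
  have c1 i' : complex_continuous (fun p : 'rV[R]_(n + n) * 'rV[R]_(n + n) => cvec p.1 i' 0).
    by apply: continuous_cvec_coord => z; exact: cvg_fst.
  have c2 i' : complex_continuous (fun p : 'rV[R]_(n + n) * 'rV[R]_(n + n) => cvec p.2 i' 0).
    by apply: continuous_cvec_coord => z; exact: cvg_snd.
  by apply: complex_continuous_mul; apply: complex_continuous_mul => //;
     apply: complex_continuous_conj.
have [s ->|s ->] := split_ordP q; case/mxvec_indexP: s => p1 p2.
  have -> : (fun p : 'rV[R]_(n + n) * 'rV[R]_(n + n) =>
      rvec (product_state (cvec p.1) (cvec p.2)) 0 (lshift _ (mxvec_index p1 p2))) =
    @complex.Re R \o (fun p => product_state (cvec p.1) (cvec p.2) p1 p2).
    by apply/funext => p; rewrite /= row_mxEl mxE mxvecE.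
  by case: (entry p1 p2).
have -> : (fun p : 'rV[R]_(n + n) * 'rV[R]_(n + n) =>
    rvec (product_state (cvec p.1) (cvec p.2)) 0 (rshift _ (mxvec_index p1 p2))) =
  @complex.Im R \o (fun p => product_state (cvec p.1) (cvec p.2) p1 p2).
  by apply/funext => p; rewrite /= row_mxEr mxE mxvecE.
by case: (entry p1 p2).
Qed.

Lemma sphere_compact n : compact [set u : 'rV[R]_n | dot u u = 1].
Proof.
have cl : closed [set u : 'rV[R]_n | dot u u = 1].
  apply: (@closed_comp _ _ (fun u : 'rV[R]_n => dot u u) [set 1]); last exact: closed_eq.
  move=> u _; have := @continuous_dot_sub R n 0 u.
  have -> : (fun a : 'rV[R]_n => dot (a - 0) (a - 0)) = (fun a => dot a a).
    by apply/funext => a; rewrite subr0.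
  exact.
have box : compact [set u : 'rV[R]_n | forall i, [set` `[-1, 1]%R] (u 0 i)].
  by apply: (@rV_compact R n (fun=> [set` `[-1, 1]%R])) => i; apply: segment_compact.
apply: (subclosed_compact cl box) => u /= u1 i; rewrite in_itv /= -ler_norml.
rewrite -[1]sqrtr1 -sqrtr_sqr ler_wsqrtr // -u1 /dot (bigD1 i) //= expr2 lerDl.
by apply: sumr_ge0 => j _; rewrite -expr2 sqr_ge0.
Qed.

(** A base of the separable cone: with both vectors normalised, every member has trace 1. *)
Definition product_states n : set 'rV[R]_(n * n * (n * n) + n * n * (n * n)) :=
  (fun p : 'rV[R]_(n + n) * 'rV[R]_(n + n) => rvec (product_state (cvec p.1) (cvec p.2))) @`
    ([set u | dot u u = 1] `*` [set u | dot u u = 1]).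

Lemma product_states_compact n : compact (@product_states n).
Proof.
apply: continuous_compact; first exact/continuous_subspaceT/continuous_product_state.
by apply: compact_setX; apply: sphere_compact.
Qed.

End Compactness.

(** * Separability from pairings with block-positive matrices *)

Section Bipolar.
Variable R : realType.
Local Notation C := R[i].

Lemma sum_pairing_herm n (W H : 'M[C]_n) : H^H = H ->
  \sum_p \sum_q (W + W^H) p q * H p q =
  (2 * complex.Re (\sum_p \sum_q W p q * H p q))%:C%C.
Proof.
move=> hH; set z := \sum_p \sum_q W p q * H p q.
have -> : \sum_p \sum_q (W + W^H) p q * H p q = z + z^*.
  rewrite /z [X in _ = _ + X](raddf_sum Num.conj) /=.
  transitivity (z + \sum_p \sum_q W^H p q * H p q).
    rewrite -big_split; apply: eq_bigr => p _ /=; rewrite -big_split.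
    by apply: eq_bigr => q _ /=; rewrite mxE mulrDl.
  congr (_ + _); rewrite exchange_big; apply: eq_bigr => p _ /=.
  rewrite (raddf_sum Num.conj); apply: eq_bigr => q _ /=.
  by rewrite rmorphM /= -{1}hH !adjmxE.
by case: z => a b; apply/eqP; rewrite eq_complex /= subrr eqxx andbT mulr2n mulrDl mul1r.
Qed.

Lemma product_state_herm n (x y : 'cV[C]_n) : (product_state x y)^H = product_state x y.
Proof.
apply/matrixP => p q; case: (mxtens_indexP p) => i k; case: (mxtens_indexP q) => j l.
by rewrite adjmxE !tensmxE rmorphM /= -!adjmxE !adj_rank1.
Qed.

(** The zero vector gets weight 0 and an arbitrary unit vector, which exists because the dimension
    is a successor. *)
Lemma outer_normalize n (x : 'cV[C]_n.+1) : exists (u : 'rV[R]_(n.+1 + n.+1)) (a : C),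
  [/\ dot u u = 1, 0 <= a & x *m x^H = a *: (cvec u *m (cvec u)^H)].
Proof.
have dot1 (z : 'cV[C]_n.+1) : (z^H *m z) 0 0 = 1 -> exists2 u, z = cvec u & dot u u = 1.
  have [u ->] := cvec_surj z; rewrite cvec_gram => /(congr1 (@complex.Re R)) /= u1.
  by exists u.
have [->|x0] := eqVneq x 0.
  have [|u _ u1] := dot1 (delta_mx 0 0).
    rewrite mxE (bigD1 0) //= big1 => [|i /negPf i0]; rewrite !mxE ?i0 ?mulr0 //.
    by rewrite eqxx conjC1 mulr1 addr0.
  by exists u, 0; rewrite mul0mx scale0r.
have N0 := gram_col_gt0 x0; set N := (_ 0 0) in N0.
have s0 : 0 <= (sqrtC N)^-1 by rewrite invr_ge0 sqrtC_ge0 ltW.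
have [|u xu u1] := dot1 ((sqrtC N)^-1 *: x).
  rewrite adjmxZ geC0_conj // -scalemxAl -scalemxAr scalerA -expr2 exprVn sqrtCK mxE.
  by rewrite -/N mulVf ?gt_eqF.
exists u, N; split=> //; first exact: ltW.
rewrite -xu adjmxZ geC0_conj // -scalemxAl -scalemxAr !scalerA -mulrA -expr2 exprVn sqrtCK.
by rewrite mulfV ?scale1r ?gt_eqF.
Qed.

Lemma trace_product_state n (x y : 'cV[C]_n) :
  \tr (product_state x y) = (x^H *m x) 0 0 * (y^H *m y) 0 0.
Proof.
rewrite /mxtrace sum_mxtens !mxE big_distrl; apply: eq_bigr => i _ /=.
rewrite big_distrr; apply: eq_bigr => k _ /=.
by rewrite tensmxE !mxE !big_ord1 !mxE; ring.
Qed.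

Lemma dot_rvec_trace n (H : 'M[C]_n) : dot (rvec 1%:M) (rvec H) = complex.Re (\tr H).
Proof.
rewrite dot_rvec /mxtrace; congr complex.Re; apply: eq_bigr => p _.
rewrite (bigD1 p) //= big1 ?addr0 => [|q /negPf qp].
  rewrite row_mxEl row_mxEr !mxE mxvecE !mxE eqxx /=.
  by rewrite oppr0 mul1r.
rewrite row_mxEl row_mxEr !mxE mxvecE !mxE eq_sym qp /= oppr0.
by rewrite mul0r.
Qed.

Lemma dot_rvec_herm n (w : 'rV[R]_(n * n + n * n)) : exists2 W : 'M[C]_n, W^H = W &
  forall H : 'M[C]_n, H^H = H -> \sum_p \sum_q W p q * H p q = (2 * dot w (rvec H))%:C%C.
Proof.
pose W : 'M[C]_n := \matrix_(p, q) Complex (w 0 (lshift _ (mxvec_index p q)))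
                                    (- w 0 (rshift _ (mxvec_index p q))).
exists (W + W^H); first by rewrite adjmxD adjmxK addrC.
move=> H /sum_pairing_herm ->; rewrite dot_rvec; congr ((2 * complex.Re _)%:C%C).
by apply: eq_bigr => p _; apply: eq_bigr => q _; rewrite mxE.
Qed.

(** The bipolar theorem with the trace as normalising functional. A dual vector w nonnegative on
    normalised product states corresponds to a Hermitian W, which by homogeneity is nonnegative on
    all product states. *)
Lemma separable_of_positive_pairing n (A : 'M[C]_(n.+1 * n.+1)) : psd A ->
  (forall W : 'M[C]_(n.+1 * n.+1), W^H = W ->
    (forall x y : 'cV[C]_n.+1, 0 <= \sum_p \sum_q W p q * product_state x y p q) ->
    0 <= \sum_p \sum_q W p q * A p q) ->
  separable A.
Proof.
move=> pA hA; split=> //; have hermA : A^H = A by case: pA.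
have [||||c [s [c0 Ss EA]]] := @cone_bipolar R _ (@product_states R n.+1) (rvec 1%:M) (rvec A).
- have [u [_ [u1 _ _]]] := @outer_normalize n 0.
  by exists (rvec (product_state (cvec u) (cvec u))), (u, u).
- exact: product_states_compact.
- move=> _ [[u v] [/= u1 v1] <-]; rewrite dot_rvec_trace trace_product_state !cvec_gram u1 v1.
  by rewrite mulr1.
- move=> w hw; have [W hW EW] := dot_rvec_herm w.
  have : 0 <= \sum_p \sum_q W p q * A p q.
    apply: hA => // x y.
    rewrite /product_state; have [u [a [u1 a0 ->]]] := outer_normalize x.
    have [v [b [v1 b0 ->]]] := outer_normalize y.
    have E : (a *: (cvec u *m (cvec u)^H)) *t (b *: (cvec v *m (cvec v)^H)) =
        (a * b) *: product_state (cvec u) (cvec v).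
      apply/matrixP => p q; case: (mxtens_indexP p) => i k; case: (mxtens_indexP q) => j l.
      by rewrite [RHS]mxE !tensmxE !mxE; ring.
    rewrite E.
    have -> : \sum_p \sum_q W p q * ((a * b) *: product_state (cvec u) (cvec v)) p q =
        a * b * \sum_p \sum_q W p q * product_state (cvec u) (cvec v) p q.
      rewrite big_distrr; apply: eq_bigr => p _; rewrite big_distrr; apply: eq_bigr => q _ /=.
      by rewrite mxE; ring.
    rewrite EW ?product_state_herm // !mulr_ge0 // -(rmorph0 (real_complex R)) lecR.
    by rewrite mulr_ge0 // hw //; exists (u, v).
  by rewrite EW // -(rmorph0 (real_complex R)) lecR pmulr_rge0.
have /fin_all_exists[x xE] : forall t, exists xy : 'cV[C]_n.+1 * 'cV[C]_n.+1,
    s t = rvec (product_state xy.1 xy.2).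
  by move=> t; have [[u v] _ <-] := Ss t; exists (cvec u, cvec v).
exists _, (fun t => (c t)%:C%C), (fun t => (x t).1 *m (x t).1^H), (fun t => (x t).2 *m (x t).2^H).
split=> [t|t|t|]; [by rewrite -(rmorph0 (real_complex R)) lecR|exact: psd_rank1|exact: psd_rank1|].
apply: (@rvec_inj R); rewrite EA rvec_sum; apply: eq_bigr => t _.
by rewrite rvecZ xE.
Qed.

End Bipolar.

Theorem theorem1 (R : realType) (phi : {linear 'M[R[i]]_3 -> 'M[R[i]]_3}) :
  PPT phi -> separable_map (fun X => phi (phi X)).
Proof.
move=> pphi; have [cp _] := pphi; rewrite /separable_map choiE.
apply: (@separable_of_positive_pairing R 2) => [|W hW posW].
  by apply: cp_choi_entries; apply: completely_positive_comp.
(* The positive map of the pairing lemma is the contraction with W. *)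
have := @ppt_square_pairing _ phi (contract W) pphi _ (fun Y => contract_adj Y hW).
have pc y := @contract_psd _ 3 W y hW posW.
move=> /(_ pc); congr (0 <= _); rewrite sum_pairing_mxtens.
apply: eq_bigr => i _; apply: eq_bigr => j _; rewrite mxE.
apply: eq_bigr => k _; apply: eq_bigr => l _; rewrite mxE !mxtens_indexK.
by [].
Qed.
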